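(* (In ZFC.) If $\kappa$ is measurable, then there is $R$ such that $(V_\kappa,\in,R)$ satisfies B1–B8 (listed in the context). Moreover, if $j:V\to M$ is an elementary embedding with critical point $\kappa$, then there is a unique (as a predicate on $V_\kappa$) $R$ such that $(V_\kappa,\in,R)$ satisfies B1–B8 and $j(R)(\kappa,\kappa)$ holds.
   Context: $M$ is a transitive inner model. The axioms are in the language of set theory with an additional binary predicate $R$; $R(n,a)$ is read ''$a$ is $n$-reflective'', $R_n=\{z:R(n,z)\}$. B1. ZFC. B2. For all $x$ there is the set $\{(y,z)\in x:R(y,z)\}$. B3. $R(y,z)\Rightarrow y$ and $z$ are ordinals. B4. $R(0,x)$ iff $x$ is a regular uncountable cardinal. B5. $R(n+1,a)\Rightarrow R(n,a)$. B6. For limit $n$, $R(n,a)\Leftrightarrow\forall m<n\ R(m,a)$. B7. For all ordinals $n,a$ and all $b,c$ with $R(n+1,b)$, $R(n+1,c)$ and $0<a<b<c$: $R(n+1,a)$ holds iff for all (codes of) formulas $\varphi$ with two free variables of set theory with a predicate for $R_n$ and all $s\in V_a$, $((V_b,\in,R_n)\models\varphi(a,s))\Leftrightarrow((V_c,\in,R_n)\models\varphi(b,s))$ (with $R_n$ restricted to $V_b$, $V_c$ respectively). B8. (Schema, $m$ a natural number) There is a $\Sigma_m^{V,R}$-correct cardinal $\mu$ with $R(\mu,\mu)$. Here $\mu$ is $\Sigma_m^{V,R}$-correct if for every formula $\varphi$ with one free variable consisting of $m$ alternating quantifiers starting with $\exists$ followed by a bounded-quantifier formula (allowing $R$), and all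 $s\in V_\mu$: $(V_\mu,\in,R)\models\varphi(s)$ iff $\varphi(s)$ holds in $V$. *)

(* Defs.v *)
Set Implicit Arguments.

(** * First-order formulas

    [formula L X] is the type of formulas with free variables in [X], in the
    language of set theory extended by the atomic formulas [L].  A quantifier
    binds the variable [None] of [option X]. *)

Inductive formula (L : Set -> Set) (X : Set) : Set :=
| Mem (x y : X)
| Equal (x y : X)
| Pred (a : L X)
| Not (p : formula L X)
| And (p q : formula L X)
| Or (p q : formula L X)
| Imp (p q : formula L X)
| All (p : formula L (option X))
| Ex (p : formula L (option X)).

Arguments Mem {L X} x y.
Arguments Equal {L X} x y.
Arguments Pred {L X} a.

(** Languages with no extra predicate, a unary one, and a binary one. *)
Definition L0 (X : Set) : Set := Empty_set.
Definition L1 (X : Set) : Set := X.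
Definition L2 (X : Set) : Set := (X * X)%type.

Inductive bounded {L : Set -> Set} {X : Set} : formula L X -> Prop :=
| bounded_Mem x y : bounded (Mem x y)
| bounded_Equal x y : bounded (Equal x y)
| bounded_Pred a : bounded (Pred a)
| bounded_Not p : bounded p -> bounded (Not p)
| bounded_And p q : bounded p -> bounded q -> bounded (And p q)
| bounded_Or p q : bounded p -> bounded q -> bounded (Or p q)
| bounded_Imp p q : bounded p -> bounded q -> bounded (Imp p q)
| bounded_All x p : @bounded L (option X) p ->
    bounded (All (Imp (Mem None (Some x)) p))
| bounded_Ex x p : @bounded L (option X) p ->
    bounded (Ex (And (Mem None (Some x)) p)).

Fixpoint alternating (start_ex : bool) (m : nat) {L : Set -> Set} {X : Set}
    (p : formula L X) {struct m} : Prop :=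
  match m with
  | O => bounded p
  | S m => exists q : formula L (option X),
      p = (if start_ex then Ex q else All q) /\ alternating (negb start_ex) m q
  end.

Definition Sigma (m : nat) {L : Set -> Set} {X : Set} (p : formula L X) : Prop :=
  alternating true m p.

(** * Satisfaction *)

Class Membership (D : Type) := mem : D -> D -> Prop.

Notation "x ∈ y" := (mem x y) (at level 70).

Instance mem_sub (D : Type) (E : Membership D) (P : D -> Prop) :
  Membership {x : D | P x} := fun x y => proj1_sig x ∈ proj1_sig y.

Definition extend {D : Type} {X : Set} (e : X -> D) (d : D) (v : option X) : D :=
  match v with None => d | Some x => e x end.

(** An interpretation of the extra atomic formulas, under an assignment. *)
Definition interp (L : Set -> Set) (D : Type) : Type :=
  forall X : Set, (X -> D) -> L X -> Prop.

Definition I0 {D : Type} : interp L0 D := fun X e a => match a with end.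
Definition I1 {D : Type} (P : D -> Prop) : interp L1 D := fun X e x => P (e x).
Definition I2 {D : Type} (R : D -> D -> Prop) : interp L2 D :=
  fun X e a => R (e (fst a)) (e (snd a)).

(** [sat U I e p]: the structure with domain [U], the membership relation and
    the predicates [I] satisfies [p] under [e].  The values of [e] are meant
    to lie in [U]. *)
Fixpoint sat {D : Type} {E : Membership D} (U : D -> Prop) {L : Set -> Set}
    (I : interp L D) {X : Set} (e : X -> D) (p : formula L X) : Prop :=
  match p with
  | Mem x y => e x ∈ e y
  | Equal x y => e x = e y
  | Pred a => I X e a
  | Not p => ~ sat U I e p
  | And p q => sat U I e p /\ sat U I e q
  | Or p q => sat U I e p \/ sat U I e q
  | Imp p q => sat U I e p -> sat U I e q
  | All p => forall d, U d -> sat U I (extend e d) p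
  | Ex p => exists d, U d /\ sat U I (extend e d) p
  end.

Definition everything {D : Type} (x : D) : Prop := True.

(** * Set-theoretic notions, interpreted in a structure [D] *)

Section Notions.

Context {D : Type} {E : Membership D}.

Definition subset (x y : D) : Prop := forall z, z ∈ x -> z ∈ y.

Definition is_empty (x : D) : Prop := forall z, ~ z ∈ x.

Definition is_upair (p x y : D) : Prop := forall z, z ∈ p <-> z = x \/ z = y.

Definition is_opair (p x y : D) : Prop :=
  exists a b, is_upair a x x /\ is_upair b x y /\ is_upair p a b.

Definition is_succ (s x : D) : Prop := forall z, z ∈ s <-> z ∈ x \/ z = x.

Definition transitive (x : D) : Prop := forall y, y ∈ x -> subset y x.

Definition ordinal (x : D) : Prop :=
  transitive x /\ forall y, y ∈ x -> transitive y.

Definition limit_ordinal (x : D) : Prop :=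
  ordinal x /\ ~ is_empty x /\
  forall y, y ∈ x -> exists s, is_succ s y /\ s ∈ x.

Definition is_omega (w : D) : Prop :=
  limit_ordinal w /\ forall n, n ∈ w -> ~ limit_ordinal n.

(** [rel r x y]: the ordered pair (x, y) belongs to [r]. *)
Definition rel (r x y : D) : Prop := exists p, is_opair p x y /\ p ∈ r.

Definition is_function (f a b : D) : Prop :=
  (forall p, p ∈ f -> exists x y, is_opair p x y /\ x ∈ a /\ y ∈ b) /\
  (forall x, x ∈ a -> exists! y, rel f x y).

Definition cardinal (k : D) : Prop :=
  ordinal k /\
  forall a f, a ∈ k -> is_function f a k ->
    ~ (forall y, y ∈ k -> exists x, x ∈ a /\ rel f x y).

Definition uncountable_cardinal (k : D) : Prop :=
  cardinal k /\ exists w, is_omega w /\ w ∈ k.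

Definition regular_uncountable (k : D) : Prop :=
  uncountable_cardinal k /\
  forall a f, a ∈ k -> is_function f a k ->
    exists b, b ∈ k /\ forall x y, rel f x y -> y ∈ b.

(** [U] is a [k]-complete nonprincipal ultrafilter on [k]. *)
Definition measure_on (k U : D) : Prop :=
  (forall X, X ∈ U -> subset X k) /\
  (forall X Y, X ∈ U -> subset X Y -> subset Y k -> Y ∈ U) /\
  (forall X Y, subset X k -> (forall z, z ∈ Y <-> z ∈ k /\ ~ z ∈ X) ->
     (X ∈ U <-> ~ Y ∈ U)) /\
  (forall g f Y, g ∈ k -> is_function f g U ->
     (forall z, z ∈ Y <-> z ∈ k /\ forall i X, rel f i X -> z ∈ X) -> Y ∈ U) /\
  (forall x X, x ∈ k -> is_upair X x x -> ~ X ∈ U).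

Definition measurable (k : D) : Prop :=
  uncountable_cardinal k /\ exists U, measure_on k U.

(** [inV a x]: x belongs to V_a, where V_a is the union of the powersets of
    V_b for b < a.  As an inductive predicate this is the intended V_a only if
    membership on [D] is well-founded. *)
Inductive inV (a x : D) : Prop :=
| inV_intro b : b ∈ a -> (forall y, y ∈ x -> inV b y) -> inV a x.

(** The axioms of ZFC, with Separation for the classes in [C1] and Replacement
    for the class functions in [C2]. *)
Record ZFC (C1 : (D -> Prop) -> Prop) (C2 : (D -> D -> Prop) -> Prop) : Prop := {
  extensionality : forall x y : D, (forall z, z ∈ x <-> z ∈ y) -> x = y;
  foundation : forall x : D, ~ is_empty x ->
    exists y, y ∈ x /\ forall z, z ∈ y -> ~ z ∈ x;
  pairing : forall x y : D, exists p, is_upair p x y;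
  union : forall x : D, exists u, forall z, z ∈ u <-> exists y, y ∈ x /\ z ∈ y;
  powerset : forall x : D, exists p, forall z, z ∈ p <-> subset z x;
  infinity : exists w : D, (exists z, is_empty z /\ z ∈ w) /\
    forall x, x ∈ w -> exists s, is_succ s x /\ s ∈ w;
  separation : forall P, C1 P ->
    forall x : D, exists y, forall z, z ∈ y <-> z ∈ x /\ P z;
  replacement : forall F, C2 F ->
    forall x : D, (forall u, u ∈ x -> exists! v, F u v) ->
    exists y, forall v, v ∈ y <-> exists u, u ∈ x /\ F u v;
  choice : forall x : D,
    (forall y, y ∈ x -> ~ is_empty y) ->
    (forall y z, y ∈ x -> z ∈ x -> (exists t, t ∈ y /\ t ∈ z) -> y = z) ->
    exists c, forall y, y ∈ x -> exists! t, t ∈ y /\ t ∈ c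
}.

(** Classes definable from parameters in the language of set theory. *)
Definition definable1 (P : D -> Prop) : Prop :=
  exists (p : formula L0 (option nat)) (e : nat -> D),
    forall x, P x <-> sat everything I0 (extend e x) p.

Definition definable2 (F : D -> D -> Prop) : Prop :=
  exists (p : formula L0 (option (option nat))) (e : nat -> D),
    forall x y, F x y <-> sat everything I0 (extend (extend e x) y) p.

Definition first_order_ZFC : Prop := ZFC definable1 definable2.

(** The universe of all sets: every predicate on the type is a class, so that
    Separation and Replacement apply to predicates mentioning an arbitrary
    class function, such as an elementary embedding. *)
Definition universe_of_sets : Prop := ZFC (fun _ => True) (fun _ => True).

End Notions.

Arguments first_order_ZFC D {E}.
Arguments universe_of_sets D {E}.

(** * The axioms B1-B8, in a structure [D] with a binary predicate [R]

    [D] is meant to be well-founded, as every V_k is.  Then the elements of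
    omega in [D] are the numerals, so that the codes of formulas in [D] and the
    natural numbers of a schema are those of [formula] and [nat], and
    satisfaction in (V_b, ∈, R_n), computed in [D], is given by [sat]. *)

Section System.

Context {D : Type} {E : Membership D}.
Context (R : D -> D -> Prop).

(** The schemas of ZFC are for formulas without [R]. *)
Definition B1 : Prop := first_order_ZFC D.

Definition B2 : Prop := forall x, exists w, forall p,
  p ∈ w <-> p ∈ x /\ exists y z, is_opair p y z /\ R y z.

Definition B3 : Prop := forall y z, R y z -> ordinal y /\ ordinal z.

Definition B4 : Prop := forall n x, is_empty n -> (R n x <-> regular_uncountable x).

Definition B5 : Prop := forall n n1 a, is_succ n1 n -> R n1 a -> R n a.

Definition B6 : Prop := forall n a, limit_ordinal n ->
  (R n a <-> forall m, m ∈ n -> R m a).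

(** The two free variables of a formula are [true] and [false]. *)
Definition pair_assignment (a s : D) (v : bool) : D := if v then a else s.

Definition B7 : Prop := forall n n1 a b c,
  ordinal n -> is_succ n1 n -> ordinal a ->
  R n1 b -> R n1 c -> ~ is_empty a -> a ∈ b -> b ∈ c ->
  (R n1 a <->
   forall (p : formula L1 bool) (s : D), inV a s ->
     (sat (inV b) (I1 (R n)) (pair_assignment a s) p <->
      sat (inV c) (I1 (R n)) (pair_assignment b s) p)).

Definition Sigma_correct (m : nat) (mu : D) : Prop :=
  forall (p : formula L2 unit) (s : D), Sigma m p -> inV mu s ->
    (sat (inV mu) (I2 R) (fun _ => s) p <-> sat everything (I2 R) (fun _ => s) p).

Definition B8 : Prop := forall m : nat, exists mu,
  cardinal mu /\ Sigma_correct m mu /\ R mu mu.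

Definition satisfies_B1_B8 : Prop :=
  B1 /\ B2 /\ B3 /\ B4 /\ B5 /\ B6 /\ B7 /\ B8.

End System.

(** * Structures on V_k and elementary embeddings of the universe *)

Section Universe.

Context {V : Type} {E : Membership V}.

(** The predicates on V_k are the sets [r] of ordered pairs of elements of
    V_k. *)
Definition predicate_on_V (k r : V) : Prop :=
  forall p, p ∈ r -> exists x y, is_opair p x y /\ inV k x /\ inV k y.

Definition V_satisfies_B1_B8 (k r : V) : Prop :=
  satisfies_B1_B8 (fun x y : {x : V | inV k x} => rel r (proj1_sig x) (proj1_sig y)).

Definition inner_model (M : V -> Prop) : Prop :=
  (forall x y, M x -> y ∈ x -> M y) /\
  (forall a, ordinal a -> M a) /\
  first_order_ZFC {x : V | M x}.

Definition elementary_embedding (j : V -> V) (M : V -> Prop) : Prop :=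
  (forall x, M (j x)) /\
  forall (p : formula L0 nat) (e : nat -> V),
    sat everything I0 e p <-> sat M I0 (fun v => j (e v)) p.

Definition critical_point (j : V -> V) (k : V) : Prop :=
  ordinal k /\ j k <> k /\ forall a, a ∈ k -> j a = a.

End Universe.

(* Main.v *)
(** With [U] a normal measure on [k], the structure [D] = V_k is itself a universe of sets,
    and [U] becomes a normal ultrafilter of classes, complete for families indexed by sets.
    The predicate is forced: R_(n+1) consists of the [a] such that, for all [p] and all
    [s] in V_a, (D, R_n) satisfies p(a, s) iff (D, R_n) satisfies p(xi, s) for
    [U]-almost all [xi].  Indeed, almost all [b] have this property, lie in R_(n+1) and
    make V_b an elementary submodel of (D, R_n), so that B7 applied to generic [b] and [c]
    decides [a].  Conversely, this recursion gives a solution: V_b is elementary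
    in (D, R_n) for every [b] in R_(n+1), because the agreement of V_xi and [D]
    on p(u, v), as a statement about [xi] with parameter the pair (u, v), holds for
    almost all [xi] and hence for [b].  An embedding enters only through the normal measure
    {X : k is in j(X)}, and j(R)(k, k) means that R(xi, xi) for almost all [xi]. *)

Require Import Defs.
From Stdlib Require Import Classical ClassicalEpsilon FunctionalExtensionality
  PropExtensionality ProofIrrelevance Cantor.

Set Implicit Arguments.
Unset Strict Implicit.


(* No ultrapower is formed. [D] has Separation and Replacement for all predicates, so Rocq
   predicates and functions serve as its classes, and first-order formulas appear only where the
   axioms or the elementarity of [j] mention them. B7 quantifies over all formulas at once, so a
   single [b] has to be generic for all of them; as formulas have numerical codes, countable
   completeness provides it. For one formula at a time, truth in V_b is definable from [b] by
   relativizing quantifiers, so no truth predicate is required. The passage to V_k has an obstacle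
   of its own: a measure is complete for families indexed by ordinals below [k], whereas inside V_k
   the index is an arbitrary set, and Replacement in V_k rests on the inaccessibility of [k]. Both
   are extracted from one fact: a function into an element of V_k is constant almost everywhere. If
   only measurability is given, the measure is first replaced by a normal one. *)
Existing Class universe_of_sets.

Lemma skolem {A B : Type} (b : inhabited B) (P : A -> Prop) (R : A -> B -> Prop) :
  (forall x, P x -> exists y, R x y) -> exists f, forall x, P x -> R x (f x).
Proof.
  intros H. exists (fun x => epsilon b (R x)). intros x Hx.
  apply epsilon_spec, H, Hx.
Qed.

Arguments skolem {A B} b P R H.

(** * Sets *)

Section Sets.

Context {D : Type} {E : Membership D} {HD : universe_of_sets D}.

Lemma set_ext (x y : D) : (forall z, z ∈ x <-> z ∈ y) -> x = y.
Proof. apply (extensionality HD). Qed.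

(** Indefinite description turns the existence axioms into functions, so that sets can be written as
    terms; extensionality makes the choice immaterial. *)
Definition sep (x : D) (P : D -> Prop) : D :=
  proj1_sig (constructive_indefinite_description _ (separation HD P I x)).

Lemma in_sep x P z : z ∈ sep x P <-> z ∈ x /\ P z.
Proof. unfold sep. destruct constructive_indefinite_description as [s Hs]. apply Hs. Qed.

Lemma unique_eq (x : D) (F : D -> D) (u : D) : u ∈ x -> exists! v, v = F u.
Proof. intros _. exists (F u). split; auto. Qed.

Definition img (F : D -> D) (x : D) : D :=
  proj1_sig (constructive_indefinite_description _
    (replacement HD (fun u v => v = F u) I x (@unique_eq x F))).

Lemma in_img F x v : v ∈ img F x <-> exists u, u ∈ x /\ v = F u.
Proof. unfold img. destruct constructive_indefinite_description as [s Hs]. apply Hs. Qed.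

Definition upair (x y : D) : D :=
  proj1_sig (constructive_indefinite_description _ (pairing HD x y)).

Lemma in_upair x y z : z ∈ upair x y <-> z = x \/ z = y.
Proof. unfold upair. destruct constructive_indefinite_description as [s Hs]. apply Hs. Qed.

Definition Union (x : D) : D :=
  proj1_sig (constructive_indefinite_description _ (union HD x)).

Lemma in_Union x z : z ∈ Union x <-> exists y, y ∈ x /\ z ∈ y.
Proof. unfold Union. destruct constructive_indefinite_description as [s Hs]. apply Hs. Qed.

Definition pow (x : D) : D :=
  proj1_sig (constructive_indefinite_description _ (powerset HD x)).

Lemma in_pow x z : z ∈ pow x <-> subset z x.
Proof. unfold pow. destruct constructive_indefinite_description as [s Hs]. apply Hs. Qed.

Definition Succ (x : D) : D := Union (upair x (upair x x)).

Lemma in_Succ x z : z ∈ Succ x <-> z ∈ x \/ z = x.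
Proof.
  unfold Succ. rewrite in_Union. split.
  - intros (y & Hy & Hz). apply in_upair in Hy as [-> | ->]; auto.
    apply in_upair in Hz. tauto.
  - intros [Hz | ->].
    + exists x. rewrite in_upair. auto.
    + exists (upair x x). rewrite !in_upair. auto.
Qed.

Definition inductive_set : D :=
  proj1_sig (constructive_indefinite_description _ (infinity HD)).

Definition emp : D := sep inductive_set (fun _ => False).

Lemma in_emp z : ~ z ∈ emp.
Proof. unfold emp. rewrite in_sep. tauto. Qed.

Lemma is_empty_eq x : is_empty x <-> x = emp.
Proof.
  split.
  - intros H. apply set_ext. intros z. split; intros Hz.
    + destruct (H z Hz).
    + destruct (in_emp Hz).
  - intros -> z. apply in_emp.
Qed.

Lemma nonempty x : x <> emp -> exists y, y ∈ x.
Proof.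
  intros H. apply NNPP. intros H1. apply H, is_empty_eq.
  intros z Hz. apply H1. eauto.
Qed.

Lemma is_upair_eq p x y : is_upair p x y <-> p = upair x y.
Proof.
  split.
  - intros H. apply set_ext. intros z. rewrite in_upair. apply H.
  - intros -> z. apply in_upair.
Qed.

Lemma is_succ_eq s x : is_succ s x <-> s = Succ x.
Proof.
  split.
  - intros H. apply set_ext. intros z. rewrite in_Succ. apply H.
  - intros -> z. apply in_Succ.
Qed.

Definition opair (x y : D) : D := upair (upair x x) (upair x y).

Lemma is_opair_eq p x y : is_opair p x y <-> p = opair x y.
Proof.
  unfold is_opair. split.
  - intros (a & b & Ha & Hb & Hp). apply is_upair_eq in Ha, Hb, Hp. subst. reflexivity.
  - intros ->. exists (upair x x), (upair x y). rewrite !is_upair_eq. auto.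
Qed.

Lemma upair_inj_l x y y' : upair x y = upair x y' -> y = y'.
Proof.
  intros H.
  assert (H1 : y ∈ upair x y') by (rewrite <- H; apply in_upair; auto).
  assert (H2 : y' ∈ upair x y) by (rewrite H; apply in_upair; auto).
  apply in_upair in H1, H2. destruct H1, H2; congruence.
Qed.

Lemma upair_sing x y z : upair x x = upair y z -> x = y /\ x = z.
Proof.
  intros H.
  assert (H1 : y ∈ upair x x) by (rewrite H; apply in_upair; auto).
  assert (H2 : z ∈ upair x x) by (rewrite H; apply in_upair; auto).
  apply in_upair in H1, H2. destruct H1, H2; split; congruence.
Qed.

Lemma opair_inj x y x' y' : opair x y = opair x' y' -> x = x' /\ y = y'.
Proof.
  unfold opair. intros H.
  assert (Hx : x = x').
  { assert (H1 : upair x x ∈ upair (upair x' x') (upair x' y'))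
      by (rewrite <- H; apply in_upair; auto).
    apply in_upair in H1 as [H1 | H1]; apply upair_sing in H1; tauto. }
  subst x'. split; auto. apply upair_inj_l in H. apply upair_inj_l in H. auto.
Qed.

Lemma rel_opair r x y : rel r x y <-> opair x y ∈ r.
Proof.
  unfold rel. split.
  - intros (p & Hp & H). apply is_opair_eq in Hp. subst. auto.
  - intros H. exists (opair x y). rewrite is_opair_eq. auto.
Qed.

Definition graph (A B : D) (R : D -> D -> Prop) : D :=
  Union (img (fun x => img (opair x) (sep B (R x))) A).

Lemma in_graph A B R p :
  p ∈ graph A B R <-> exists x y, p = opair x y /\ x ∈ A /\ y ∈ B /\ R x y.
Proof.
  unfold graph. rewrite in_Union. split.
  - intros (s & Hs & Hp). apply in_img in Hs as (x & Hx & ->).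
    apply in_img in Hp as (y & Hy & ->). apply in_sep in Hy. exists x, y. tauto.
  - intros (x & y & -> & Hx & Hy & HR). exists (img (opair x) (sep B (R x))).
    rewrite !in_img. split; [eauto | exists y; rewrite in_sep; auto].
Qed.

Lemma rel_graph A B R x y : rel (graph A B R) x y <-> x ∈ A /\ y ∈ B /\ R x y.
Proof.
  rewrite rel_opair, in_graph. split.
  - intros (x' & y' & H & H'). apply opair_inj in H as [<- <-]. auto.
  - intros H. eauto.
Qed.

Lemma mem_irrefl x : ~ x ∈ x.
Proof.
  intros H. destruct (foundation HD (x := upair x x)) as (y & Hy & Hmin).
  - intros H1. apply (H1 x), in_upair. auto.
  - assert (y = x) by (apply in_upair in Hy; tauto). subst y.
    apply (Hmin x H), in_upair. auto.
Qed.

Fixpoint num (n : nat) : D :=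
  match n with O => emp | S n => Succ (num n) end.

Lemma num_lt m n : m < n -> num m ∈ num n.
Proof.
  induction 1; simpl; apply in_Succ; auto.
Qed.

Lemma num_inj m n : num m = num n -> m = n.
Proof.
  intros H. destruct (PeanoNat.Nat.lt_trichotomy m n) as [L | [L | L]]; auto;
    apply num_lt in L; rewrite H in L; destruct (mem_irrefl L).
Qed.

Lemma num_inductive n : num n ∈ inductive_set.
Proof.
  unfold inductive_set. destruct constructive_indefinite_description as [w [H0 HS]].
  simpl. induction n as [|n IH]; simpl.
  - destruct H0 as (z & Hz & H). apply is_empty_eq in Hz. subst. auto.
  - destruct (HS _ IH) as (s & Hs & H). apply is_succ_eq in Hs. subst. auto.
Qed.

(** Separation accepts the external predicate of being a numeral, so this [omega] is standard by
    construction. *)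
Definition omega : D := sep inductive_set (fun x => exists n, x = num n).

Lemma in_omega x : x ∈ omega <-> exists n, x = num n.
Proof.
  unfold omega. rewrite in_sep. split; [tauto |].
  intros [n ->]. split; eauto using num_inductive.
Qed.

(** Replacement along [omega]: by injectivity of [num] the external index is recovered from its
    numeral, so the range of any external sequence is a set. *)
Lemma nat_family (f : nat -> D) : exists s, forall v, v ∈ s <-> exists n, v = f n.
Proof.
  exists (img (fun u => f (epsilon (inhabits 0) (fun n => u = num n))) omega).
  intros v. rewrite in_img.
  assert (H : forall n, epsilon (inhabits 0) (fun m => num n = num m) = n).
  { intros n. symmetry. apply num_inj. apply epsilon_spec with (P := fun m => num n = num m). eauto. }
  split.
  - intros (u & Hu & ->). eauto.
  - intros (n & ->). exists (num n). rewrite H. split; auto. apply in_omega. eauto.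
Qed.

(** The foundation axiom handles only sets, so the inaccessible points are collected inside the
    transitive closure of {x}. That closure is a set because its levels form an external
    sequence. *)
Lemma mem_wf : well_founded (fun x y : D => x ∈ y).
Proof.
  intros x. apply NNPP. intros Hx.
  set (lvl := nat_rect (fun _ => D) (upair x x) (fun _ => Union)).
  destruct (nat_family lvl) as [s Hs].
  set (T := sep (Union s) (fun y => ~ Acc (fun x y : D => x ∈ y) y)).
  destruct (foundation HD (x := T)) as (y & Hy & Hmin).
  - intros H. apply (H x). apply in_sep. split; auto.
    apply in_Union. exists (lvl 0). split; [apply Hs; eauto |]. apply in_upair. auto.
  - apply in_sep in Hy as [Hy1 Hy2]. apply Hy2. constructor. intros z Hz.
    apply NNPP. intros Hz2. apply (Hmin z Hz), in_sep. split; auto.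
    apply in_Union in Hy1 as (l & Hl & Hyl). apply Hs in Hl as [n ->].
    apply in_Union. exists (lvl (S n)). split; [apply Hs; eauto |].
    simpl. apply in_Union. eauto.
Qed.

Lemma mem_ind (P : D -> Prop) : (forall x, (forall y, y ∈ x -> P y) -> P x) -> forall x, P x.
Proof. intros H x. induction (mem_wf x) as [x _ IH]. auto. Qed.

Lemma mem_min (P : D -> Prop) : (exists x, P x) -> exists x, P x /\ forall y, y ∈ x -> ~ P y.
Proof.
  intros [x Hx]. apply NNPP. intros H. revert x Hx.
  induction x as [x IH] using mem_ind. intros Hx. apply H. exists x. split; auto.
Qed.

(** * Ordinals *)

Lemma ordinal_elem x y : ordinal x -> y ∈ x -> ordinal y.
Proof.
  intros [Hx Hx'] Hy. split; [apply Hx'; auto |]. intros z Hz. apply Hx'. exact (Hx y Hy z Hz).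
Qed.

Lemma ordinal_trans x y z : ordinal x -> y ∈ x -> z ∈ y -> z ∈ x.
Proof. intros [Hx _] Hy Hz. exact (Hx y Hy z Hz). Qed.

Lemma trichotomy x y : ordinal x -> ordinal y -> x ∈ y \/ x = y \/ y ∈ x.
Proof.
  revert y. induction x as [x IHx] using mem_ind. intros y. 
  induction y as [y IHy] using mem_ind. intros Ox Oy.
  apply NNPP. intros H. assert (x = y); [| tauto].
  apply set_ext. intros z. split; intros Hz.
  - destruct (IHx z Hz y (ordinal_elem Ox Hz) Oy) as [|[-> |]]; auto; [tauto|].
    destruct H. right; right. eapply ordinal_trans; eauto.
  - destruct (IHy z Hz Ox (ordinal_elem Oy Hz)) as [|[-> |]]; auto; [|tauto].
    destruct H. left. eapply ordinal_trans; eauto.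
Qed.

Lemma subset_ordinal x y : ordinal x -> ordinal y -> subset x y -> x ∈ y \/ x = y.
Proof.
  intros Ox Oy H. destruct (trichotomy Ox Oy) as [|[|Hy]]; auto.
  destruct (mem_irrefl (H y Hy)).
Qed.

Lemma ordinal_emp : ordinal emp.
Proof. split; intros y Hy; destruct (in_emp Hy). Qed.

Lemma ordinal_Succ x : ordinal x -> ordinal (Succ x).
Proof.
  intros [H1 H2]. split.
  - intros y Hy z Hz. apply in_Succ. left. apply in_Succ in Hy as [Hy | ->]; auto. exact (H1 y Hy z Hz).
  - intros y Hy. apply in_Succ in Hy as [Hy | ->]; auto.
Qed.

Lemma ordinal_num n : ordinal (num n).
Proof. induction n; simpl; auto using ordinal_emp, ordinal_Succ. Qed.

Lemma mem_Succ x : x ∈ Succ x.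
Proof. apply in_Succ. auto. Qed.

Lemma Succ_mem_or_eq x y : ordinal x -> y ∈ x -> Succ y ∈ x \/ Succ y = x.
Proof.
  intros Ox Hy. apply subset_ordinal; auto.
  - apply ordinal_Succ. eapply ordinal_elem; eauto.
  - intros z Hz. apply in_Succ in Hz as [Hz | ->]; auto. eapply ordinal_trans; eauto.
Qed.

Lemma limit_ordinal_iff x :
  limit_ordinal x <-> ordinal x /\ x <> emp /\ forall y, y ∈ x -> Succ y ∈ x.
Proof.
  unfold limit_ordinal. rewrite is_empty_eq. split; intros (O & N & H); (split; [|split]); auto; intros y Hy.
  - destruct (H y Hy) as (s & Hs & Hsx). apply is_succ_eq in Hs. subst. auto.
  - exists (Succ y). rewrite is_succ_eq. auto.
Qed.

Lemma limit_num x n : limit_ordinal x -> num n ∈ x.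
Proof.
  rewrite limit_ordinal_iff. intros (O & N & H). induction n as [|n IH]; simpl; auto.
  destruct (trichotomy O ordinal_emp) as [Hx|[Hx|Hx]]; auto; [destruct (in_emp Hx) | tauto].
Qed.

Lemma ordinal_cases x : ordinal x -> x = emp \/ (exists y, ordinal y /\ x = Succ y) \/ limit_ordinal x.
Proof.
  intros O. destruct (classic (x = emp)) as [|N]; auto. right.
  destruct (classic (exists y, y ∈ x /\ Succ y = x)) as [(y & Hy & H)|H].
  - left. exists y. split; auto. eapply ordinal_elem; eauto.
  - right. apply limit_ordinal_iff. split; [|split]; auto. intros y Hy.
    destruct (Succ_mem_or_eq O Hy); auto. destruct H. eauto.
Qed.

Lemma is_omega_omega : is_omega omega.
Proof.
  split.
  - apply limit_ordinal_iff.
    assert (S : forall y, y ∈ omega -> Succ y ∈ omega).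
    { intros y Hy. apply in_omega in Hy as [n ->]. apply in_omega. exists (S n). auto. }
    split; [split | split]; auto.
    + intros y Hy z Hz. apply in_omega in Hy as [n ->]. apply in_omega.
      induction n as [|n IH]; simpl in Hz.
      * destruct (in_emp Hz).
      * apply in_Succ in Hz as [Hz | ->]; eauto.
    + intros y Hy. apply in_omega in Hy as [n ->]. apply ordinal_num.
    + intros H. apply (in_emp (z := emp)). rewrite <- H at 2. apply in_omega. exists 0. auto.
  - intros x Hn HL. apply in_omega in Hn as [n ->].
    apply limit_num with (n := n) in HL. destruct (mem_irrefl HL).
Qed.

Lemma is_omega_eq w : is_omega w -> w = omega.
Proof.
  intros [L H]. destruct is_omega_omega as [L' H'].
  destruct (trichotomy (proj1 L) (proj1 L')) as [Hw | [|Hw]]; auto.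
  - destruct (H' _ Hw L).
  - destruct (H _ Hw L').
Qed.

Lemma ordinal_bound (F : D -> D) x :
  (forall u, u ∈ x -> ordinal (F u)) -> exists b, ordinal b /\ forall u, u ∈ x -> F u ∈ b.
Proof.
  intros H. set (b := Union (img (fun u => Succ (F u)) x)).
  assert (Hb : forall z, z ∈ b <-> exists u, u ∈ x /\ z ∈ Succ (F u)).
  { intros z. unfold b. rewrite in_Union. split.
    - intros (y & Hy & Hz). apply in_img in Hy as (u & Hu & ->). eauto.
    - intros (u & Hu & Hz). exists (Succ (F u)). rewrite in_img. eauto. }
  exists b. split.
  - split.
    + intros y Hy z Hz. apply Hb in Hy as (u & Hu & Hy). apply Hb. exists u. split; auto.
      eapply ordinal_trans; eauto using ordinal_Succ.
    + intros y Hy. apply Hb in Hy as (u & Hu & Hy).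
      exact (proj1 (ordinal_elem (ordinal_Succ (H u Hu)) Hy)).
  - intros u Hu. apply Hb. eauto using mem_Succ.
Qed.

(** * The cumulative hierarchy *)

Lemma inV_iff a x : inV a x <-> exists b, b ∈ a /\ forall y, y ∈ x -> inV b y.
Proof.
  split; [intros [b Hb H]; eauto | intros (b & Hb & H); econstructor; eauto].
Qed.

Lemma inV_mono a b x : subset a b -> inV a x -> inV b x.
Proof. intros S [c Hc H]. exists c; auto. Qed.

Lemma inV_subset a x y : subset y x -> inV a x -> inV a y.
Proof. intros S [c Hc H]. exists c; auto. Qed.

Lemma inV_trans a x y : transitive a -> y ∈ x -> inV a x -> inV a y.
Proof. intros T Hy [c Hc H]. eapply inV_mono; [apply T; eauto | auto]. Qed.

Lemma inV_self a x : ordinal a -> x ∈ a -> inV a x.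
Proof.
  revert a. induction x as [x IH] using mem_ind. intros a O H. exists x; auto. intros y Hy.
  apply IH; auto. eapply ordinal_elem; eauto.
Qed.

Lemma V_set a : exists v, forall x, x ∈ v <-> inV a x.
Proof.
  induction a as [a IH] using mem_ind.
  destruct (skolem (inhabits a) _ _ IH) as [f Hf].
  exists (Union (img (fun b => pow (f b)) a)). intros x. rewrite in_Union, inV_iff. split.
  - intros (y & Hy & Hx). apply in_img in Hy as (b & Hb & ->). rewrite in_pow in Hx.
    exists b. split; auto. intros y Hy. apply Hf; auto.
  - intros (b & Hb & H). exists (pow (f b)). rewrite in_img, in_pow. split; eauto.
    intros y Hy. apply Hf; auto.
Qed.

Lemma inV_exists x : exists a, ordinal a /\ inV a x.
Proof.
  induction x as [x IH] using mem_ind.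
  destruct (skolem (inhabits x) _ _ IH) as [f Hf].
  destruct (ordinal_bound (F := f) (fun u Hu => proj1 (Hf u Hu))) as (b & Ob & Hb).
  (* The ranks of the elements lie below [b]; one more level accommodates [x] itself. *)
  exists (Succ b). split; [auto using ordinal_Succ|]. exists b; [apply mem_Succ|].
  intros y Hy. destruct (Hf y Hy) as [Oy Vy]. eapply inV_mono; [|eauto].
  apply (proj1 Ob). auto.
Qed.

(** Two elements of a limit level already occur at a common earlier level, which leaves room for
    their pair. *)
Lemma inV_bound a x y : limit_ordinal a -> inV a x -> inV a y ->
  exists b, b ∈ a /\ inV b x /\ inV b y.
Proof.
  intros L Hx Hy. apply limit_ordinal_iff in L as (O & _ & L).
  destruct Hx as [b Hb Hx], Hy as [c Hc Hy].
  pose proof (ordinal_elem O Hb) as Ob. pose proof (ordinal_elem O Hc) as Oc.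
  assert (H : exists d, d ∈ a /\ subset b d /\ subset c d).
  { destruct (trichotomy Ob Oc) as [H|[-> |H]].
    - exists c. split; [|split]; auto; [exact (proj1 Oc b H) | intros z Hz; exact Hz].
    - exists c. split; [|split]; auto; intros z Hz; exact Hz.
    - exists b. split; [|split]; auto; [intros z Hz; exact Hz | exact (proj1 Ob c H)]. }
  destruct H as (d & Hd & Sb & Sc). exists (Succ d). split; auto.
  split; exists d; auto using mem_Succ; intros z Hz;
    [apply (inV_mono Sb) | apply (inV_mono Sc)]; auto.
Qed.

Lemma inV_upair a x y : limit_ordinal a -> inV a x -> inV a y -> inV a (upair x y).
Proof.
  intros L Hx Hy. destruct (inV_bound L Hx Hy) as (b & Hb & Hbx & Hby).
  exists b; auto. intros z Hz. apply in_upair in Hz as [-> | ->]; auto.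
Qed.

Lemma inV_opair a x y : limit_ordinal a -> inV a x -> inV a y -> inV a (opair x y).
Proof. unfold opair. auto using inV_upair. Qed.

Lemma inV_opair_inv a x y : transitive a -> inV a (opair x y) -> inV a x /\ inV a y.
Proof.
  intros T H. assert (H1 : inV a (upair x y)).
  { eapply inV_trans; [auto | | exact H]. apply in_upair. auto. }
  split; (eapply inV_trans; [auto | | exact H1]); apply in_upair; auto.
Qed.

(** The function on 1 = {0} with value [y] is bounded in [a], so [a] has an element above [y]. *)
Lemma regular_limit a : regular_uncountable a -> limit_ordinal a.
Proof.
  intros [[[O _] (w & Hw & Hwa)] H]. apply limit_ordinal_iff. split; [|split]; auto.
  - intros ->. destruct (in_emp Hwa).
  - intros y Hy. set (one := num 1).
    assert (H1 : one ∈ a) by exact (ordinal_trans O Hwa (limit_num 1 (proj1 Hw))).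
    set (f := graph one a (fun _ z => z = y)).
    assert (H0 : forall x, x ∈ one <-> x = emp).
    { intros x. unfold one. simpl. rewrite in_Succ. split; auto. intros [Hx|]; auto. destruct (in_emp Hx). }
    destruct (H one f H1) as (b & Hb & Hf).
    + split.
      * intros p Hp. apply in_graph in Hp as (x & z & -> & Hx & Hz & ->).
        exists x, y. rewrite is_opair_eq. auto.
      * intros x Hx. exists y. split; [apply rel_graph; auto |].
        intros z Hz. apply rel_graph in Hz. symmetry. tauto.
    + assert (Hyb : y ∈ b) by (apply (Hf emp y), rel_graph; repeat split; auto; apply H0; auto).
      destruct (Succ_mem_or_eq (ordinal_elem O Hb) Hyb) as [L | ->]; auto.
      eapply ordinal_trans; eauto.
Qed.

End Sets.


(** * Formulas *)

Definition countable (X : Type) : Prop :=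
  exists f : X -> nat, forall x y, f x = f y -> x = y.

Definition option_code {X : Set} (c : X -> nat) (v : option X) : nat :=
  match v with None => 0 | Some x => S (c x) end.

Lemma option_code_inj {X : Set} (c : X -> nat) :
  (forall x y, c x = c y -> x = y) ->
  forall x y, option_code c x = option_code c y -> x = y.
Proof.
  intros H [x|] [y|] Hxy; try discriminate; auto. injection Hxy as Hxy.
  f_equal; auto.
Qed.

(** A Gödel numbering, so that countable completeness covers all formulas simultaneously. The coding
    [c] of variables is an argument because each quantifier enlarges the type of variables. *)
Fixpoint formula_code {L : Set -> Set} (cL : forall X : Set, (X -> nat) -> L X -> nat)
    {X : Set} (c : X -> nat) (p : formula L X) : nat :=
  match p with
  | Mem x y => to_nat (0, to_nat (c x, c y))
  | Equal x y => to_nat (1, to_nat (c x, c y))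
  | Pred a => to_nat (2, cL X c a)
  | Not p => to_nat (3, formula_code cL c p)
  | And p q => to_nat (4, to_nat (formula_code cL c p, formula_code cL c q))
  | Or p q => to_nat (5, to_nat (formula_code cL c p, formula_code cL c q))
  | Imp p q => to_nat (6, to_nat (formula_code cL c p, formula_code cL c q))
  | All p => to_nat (7, formula_code cL (option_code c) p)
  | Ex p => to_nat (8, formula_code cL (option_code c) p)
  end.

Lemma to_nat_pair_inj a b a' b' : to_nat (a, b) = to_nat (a', b') -> a = a' /\ b = b'.
Proof. intros H. apply to_nat_inj in H. injection H. auto. Qed.

Lemma formula_code_inj (L : Set -> Set) (cL : forall X : Set, (X -> nat) -> L X -> nat) :
  (forall (X : Set) (c : X -> nat), (forall x y, c x = c y -> x = y) ->
     forall a b, cL X c a = cL X c b -> a = b) ->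
  forall (X : Set) (p : formula L X) (c : X -> nat), (forall x y, c x = c y -> x = y) ->
    forall q, formula_code cL c p = formula_code cL c q -> p = q.
Proof.
  intros HL X p.
  induction p as [X x y|X x y|X a|X p IH|X p IHp q IHq|X p IHp q IHq|X p IHp q IHq|X p IH|X p IH];
    intros c Hc r; destruct r; cbn [formula_code]; intros H;
    apply to_nat_pair_inj in H as [H0 H]; try discriminate H0;
    try (apply to_nat_pair_inj in H as [H1 H2]); f_equal; eauto using option_code_inj.
Qed.

Lemma countable_option (X : Set) : countable X -> countable (option X).
Proof. intros [c Hc]. exists (option_code c). apply option_code_inj; auto. Qed.

Lemma countable_unit : countable unit.
Proof. exists (fun _ : unit => 0). intros [] []; auto. Qed.

Lemma countable_bool : countable bool.
Proof. exists (fun b : bool => if b then 1 else 0). intros [] []; auto; discriminate. Qed.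

Lemma countable_formula1 (X : Set) : countable X -> countable (formula L1 X).
Proof.
  intros [c Hc]. exists (formula_code (fun (X : Set) (c : X -> nat) (a : L1 X) => c a) c).
  intros p q. apply formula_code_inj; auto.
Qed.

Lemma countable_formula2 (X : Set) : countable X -> countable (formula L2 X).
Proof.
  intros [c Hc].
  exists (formula_code (fun (X : Set) (c : X -> nat) (a : L2 X) => to_nat (c (fst a), c (snd a))) c).
  intros p q. apply formula_code_inj; auto. clear. intros X c Hc [a b] [a' b'] H.
  apply to_nat_pair_inj in H as [H1 H2]. f_equal; auto.
Qed.

(** * Definability *)

Section Definability.

Context {D : Type} {E : Membership D}.

(** One formula has to define [Q] in all the structures [U] in [W] at once:
    for [W] consisting of [V] and a transitive class, this is absoluteness. *)
Definition defin (W : (D -> Prop) -> Prop) {L : Set -> Set} (I : interp L D)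
    {X : Set} (Q : (X -> D) -> Prop) : Prop :=
  exists p : formula L X, forall U, W U -> forall e, (forall x, U (e x)) ->
    (sat U I e p <-> Q e).

Section Closure.

Context {W : (D -> Prop) -> Prop} {L : Set -> Set} {I : interp L D} {X : Set}.

Lemma def_iff (Q Q' : (X -> D) -> Prop) :
  (forall e, Q e <-> Q' e) -> defin W I Q' -> defin W I Q.
Proof. intros H [p Hp]. exists p. intros U HU e He. rewrite H. auto. Qed.

Lemma def_mem (x y : X) : defin W I (fun e => e x ∈ e y).
Proof. exists (Mem x y). simpl. tauto. Qed.

Lemma def_eq (x y : X) : defin W I (fun e => e x = e y).
Proof. exists (Equal x y). simpl. tauto. Qed.

Lemma def_not (Q : (X -> D) -> Prop) : defin W I Q -> defin W I (fun e => ~ Q e).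
Proof. intros [p Hp]. exists (Not p). simpl. intros U HU e He. rewrite (Hp U HU e He). tauto. Qed.

Lemma def_and (Q Q' : (X -> D) -> Prop) :
  defin W I Q -> defin W I Q' -> defin W I (fun e => Q e /\ Q' e).
Proof.
  intros [p Hp] [q Hq]. exists (And p q). simpl. intros U HU e He.
  rewrite (Hp U HU e He), (Hq U HU e He). tauto.
Qed.

Lemma def_or (Q Q' : (X -> D) -> Prop) :
  defin W I Q -> defin W I Q' -> defin W I (fun e => Q e \/ Q' e).
Proof.
  intros [p Hp] [q Hq]. exists (Or p q). simpl. intros U HU e He.
  rewrite (Hp U HU e He), (Hq U HU e He). tauto.
Qed.

Lemma def_imp (Q Q' : (X -> D) -> Prop) :
  defin W I Q -> defin W I Q' -> defin W I (fun e => Q e -> Q' e).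
Proof.
  intros [p Hp] [q Hq]. exists (Imp p q). simpl. intros U HU e He.
  rewrite (Hp U HU e He), (Hq U HU e He). tauto.
Qed.

Lemma def_equiv (Q Q' : (X -> D) -> Prop) :
  defin W I Q -> defin W I Q' -> defin W I (fun e => Q e <-> Q' e).
Proof. intros H H'. apply def_and; apply def_imp; auto. Qed.

Lemma def_all (Q : (X -> D) -> D -> Prop) :
  (forall U, W U -> forall x, U x) ->
  defin W I (fun e : option X -> D => Q (fun x => e (Some x)) (e None)) ->
  defin W I (fun e => forall d, Q e d).
Proof.
  intros HW [p Hp]. exists (All p). intros U HU e He. simpl. pose proof (HW U HU) as HU'. split.
  - intros H d. apply (Hp U HU (extend e d)); auto.
  - intros H d Hd. apply (Hp U HU (extend e d)); auto. apply H.
Qed.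

Lemma def_ex (Q : (X -> D) -> D -> Prop) :
  (forall U, W U -> forall x, U x) ->
  defin W I (fun e : option X -> D => Q (fun x => e (Some x)) (e None)) ->
  defin W I (fun e => exists d, Q e d).
Proof.
  intros HW [p Hp]. exists (Ex p). intros U HU e He. simpl. pose proof (HW U HU) as HU'. split.
  - intros (d & Hd & H). exists d. apply (Hp U HU (extend e d)); auto.
  - intros (d & H). exists d. split; auto. apply (Hp U HU (extend e d)); auto.
Qed.

(** For a bounded quantifier transitivity suffices: the elements of [e y] all lie in the
    structure. *)
Lemma def_ball (y : X) (Q : (X -> D) -> D -> Prop) :
  (forall U, W U -> forall x z, U x -> z ∈ x -> U z) ->
  defin W I (fun e : option X -> D => Q (fun x => e (Some x)) (e None)) ->
  defin W I (fun e => forall d, d ∈ e y -> Q e d).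
Proof.
  intros HW [p Hp]. exists (All (Imp (Mem None (Some y)) p)). intros U HU e He. simpl.
  assert (HU' : forall d, U d -> forall x, U (extend e d x)) by (intros d Hd [x|]; simpl; auto).
  split.
  - intros H d Hd. assert (U d) by exact (HW U HU _ _ (He y) Hd). apply (Hp U HU (extend e d)); auto.
  - intros H d Hd Hdy. apply (Hp U HU (extend e d)); auto. apply H. auto.
Qed.

Lemma def_bex (y : X) (Q : (X -> D) -> D -> Prop) :
  (forall U, W U -> forall x z, U x -> z ∈ x -> U z) ->
  defin W I (fun e : option X -> D => Q (fun x => e (Some x)) (e None)) ->
  defin W I (fun e => exists d, d ∈ e y /\ Q e d).
Proof.
  intros HW [p Hp]. exists (Ex (And (Mem None (Some y)) p)). intros U HU e He. simpl.
  assert (HU' : forall d, U d -> forall x, U (extend e d x)) by (intros d Hd [x|]; simpl; auto).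
  split.
  - intros (d & Hd & Hdy & H). exists d. split; auto. apply (Hp U HU (extend e d)); auto.
  - intros (d & Hd & H). assert (U d) by exact (HW U HU _ _ (He y) Hd). exists d. split; [|split]; auto.
    apply (Hp U HU (extend e d)); auto.
Qed.

End Closure.

(** * Absoluteness of notions with bounded quantifiers *)

Section Notions.

Context {W : (D -> Prop) -> Prop} {L : Set -> Set} {I : interp L D}.
Context (HW : forall U, W U -> forall x z, U x -> z ∈ x -> U z).

Lemma def_subset (X : Set) (x y : X) : defin W I (fun e => subset (e x) (e y)).
Proof. apply def_ball; auto. apply def_mem. Qed.

(** The equivalence hidden in the definition is split so that its quantifier becomes bounded. The
    notions below are made absolute in the same manner. *)
Lemma def_upair (X : Set) (p x y : X) : defin W I (fun e => is_upair (e p) (e x) (e y)).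
Proof.
  apply def_iff with (Q' := fun e => (forall z, z ∈ e p -> z = e x \/ z = e y) /\ (e x ∈ e p /\ e y ∈ e p)).
  - intros e. unfold is_upair. split.
    + intros H. split; [|split]; intros; apply H; auto.
    + intros (H1 & H2 & H3) z. split; auto. intros [-> | ->]; auto.
  - apply def_and; [apply def_ball; auto; apply def_or; apply def_eq | apply def_and; apply def_mem].
Qed.

Lemma def_opair (X : Set) (p x y : X) : defin W I (fun e => is_opair (e p) (e x) (e y)).
Proof.
  apply def_iff with (Q' := fun e => exists a, a ∈ e p /\ exists b, b ∈ e p /\
    (is_upair a (e x) (e x) /\ is_upair b (e x) (e y) /\ is_upair (e p) a b)).
  - intros e. unfold is_opair. split.
    + intros (a & b & Ha & Hb & Hp). exists a. split; [apply Hp; auto|].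
      exists b. split; [apply Hp; auto|]. auto.
    + intros (a & _ & b & _ & H). eauto.
  - apply def_bex; auto. apply def_bex; auto. repeat apply def_and; apply def_upair; auto.
Qed.

Lemma def_rel (X : Set) (r x y : X) : defin W I (fun e => rel (e r) (e x) (e y)).
Proof.
  apply def_iff with (Q' := fun e => exists p, p ∈ e r /\ is_opair p (e x) (e y)).
  - intros e. unfold rel. split; intros (p & H); exists p; tauto.
  - apply def_bex; auto. apply def_opair.
Qed.

Lemma def_transitive (X : Set) (x : X) : defin W I (fun e => transitive (e x)).
Proof. apply def_ball; auto. apply def_subset; auto. Qed.

Lemma def_ordinal (X : Set) (x : X) : defin W I (fun e => ordinal (e x)).
Proof. apply def_and; [|apply def_ball; auto]; apply def_transitive. Qed.

Lemma def_succ (X : Set) (s x : X) : defin W I (fun e => is_succ (e s) (e x)).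
Proof.
  apply def_iff with (Q' := fun e => (forall z, z ∈ e s -> z ∈ e x \/ z = e x) /\
    ((forall z, z ∈ e x -> z ∈ e s) /\ e x ∈ e s)).
  - intros e. unfold is_succ. split.
    + intros H. split; [|split]; intros; apply H; auto.
    + intros (H1 & H2 & H3) z. split; auto. intros [Hz | ->]; auto.
  - apply def_and; [|apply def_and]; try (apply def_ball; auto); [apply def_or| |]; 
      try apply def_mem. apply def_eq.
Qed.

Lemma def_limit (X : Set) (x : X) : defin W I (fun e => limit_ordinal (e x)).
Proof.
  (* The trivial [y = y] is the matrix of a bounded quantifier that says that [e x] is nonempty. *)
  apply def_iff with (Q' := fun e => ordinal (e x) /\
    ((exists y, y ∈ e x /\ y = y) /\ (forall y, y ∈ e x -> exists s, s ∈ e x /\ is_succ s y))).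
  - intros e. unfold limit_ordinal, is_empty. split; intros (O & N & H).
    + split; [|split]; auto.
      * apply NNPP. intros N'. apply N. intros z Hz. apply N'. eauto.
      * intros y Hy. destruct (H y Hy) as (s & Hs). exists s. tauto.
    + split; [|split]; auto.
      * intros N'. destruct N as (y & Hy & _). exact (N' y Hy).
      * intros y Hy. destruct (H y Hy) as (s & Hs). exists s. tauto.
  - apply def_and; [apply def_ordinal|]. apply def_and.
    + apply def_bex; auto. apply def_eq.
    + apply def_ball; auto. apply def_bex; auto. apply def_succ.
Qed.

Lemma def_omega (X : Set) (x : X) : defin W I (fun e => is_omega (e x)).
Proof.
  apply def_and; [apply def_limit|]. apply def_ball; auto. apply def_not, def_limit.
Qed.

End Notions.

(** Relativization of the quantifiers of [p] to the class [N (e z)], for one external formula at a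
    time. The renaming [f] places the variables of [p] in a context that also contains [z]. *)
Lemma def_sat (P : D -> Prop) (N : D -> D -> Prop) :
  (forall (Y : Set) (z x : Y), defin (eq everything) (I1 P) (fun e => N (e z) (e x))) ->
  forall (X : Set) (p : formula L1 X) (Y : Set) (f : X -> Y) (z : Y),
    defin (eq everything) (I1 P) (fun e => sat (N (e z)) (I1 P) (fun x => e (f x)) p).
Proof.
  intros HN X p.
  assert (HW : forall U : D -> Prop, everything = U -> forall x, U x) by (intros U <- x; exact I).
  assert (Hext : forall (X Y : Set) (f : X -> Y) (e : option Y -> D),
    (fun x => e (option_map f x)) = extend (fun x => e (Some (f x))) (e None))
    by (intros; apply functional_extensionality; intros [x|]; auto).
  induction p as [X x y|X x y|X a|X p IH|X p IHp q IHq|X p IHp q IHq|X p IHp q IHq|X p IH|X p IH];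
    intros Y f z; simpl.
  - apply def_mem.
  - apply def_eq.
  - exists (Pred (f a : L1 Y)). intros U _ e _. simpl. unfold I1. tauto.
  - apply def_not; auto.
  - apply def_and; auto.
  - apply def_or; auto.
  - apply def_imp; auto.
  - apply def_all; auto. apply def_imp; auto.
    refine (def_iff _ (IH (option Y) (option_map f) (Some z))).
    intros e. rewrite Hext. reflexivity.
  - apply def_ex; auto. apply def_and; auto.
    refine (def_iff _ (IH (option Y) (option_map f) (Some z))).
    intros e. rewrite Hext. reflexivity.
Qed.

End Definability.

(** [inV] is witnessed by a set of pairs closed backwards under its defining
    clause; well-foundedness makes such a witness sufficient. *)
Lemma inV_witness {D : Type} {E : Membership D} {HD : universe_of_sets D} (a x : D) :
  inV a x <-> exists g, rel g a x /\
    forall a' x', rel g a' x' -> exists b, b ∈ a' /\ forall y, y ∈ x' -> rel g b y.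
Proof.
  split.
  - induction 1 as [a x b Hb H IH].
    destruct (skolem (inhabits a) _ _ IH) as [g Hg].
    set (G := Union (upair (upair (opair a x) (opair a x)) (Union (img g x)))).
    assert (HG : forall p, p ∈ G <-> p = opair a x \/ exists y, y ∈ x /\ p ∈ g y).
    { intros p. unfold G. rewrite in_Union. split.
      - intros (y & Hy & Hp). apply in_upair in Hy as [-> | ->].
        + apply in_upair in Hp. tauto.
        + right. apply in_Union in Hp as (t & Ht & Hp). apply in_img in Ht as (u & Hu & ->). eauto.
      - intros [-> | (y & Hy & Hp)].
        + exists (upair (opair a x) (opair a x)). rewrite !in_upair. auto.
        + exists (Union (img g x)). rewrite in_upair, in_Union. split; auto.
          exists (g y). rewrite in_img. eauto. }
    exists G. split; [apply rel_opair, HG; auto|].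
    intros a' x' Hr. apply rel_opair, HG in Hr as [Hr | (y & Hy & Hr)].
    + apply opair_inj in Hr as [-> ->]. exists b. split; auto. intros y Hy.
      apply rel_opair, HG. right. exists y. split; auto. apply rel_opair, Hg. auto.
    + apply rel_opair in Hr. destruct (proj2 (Hg y Hy) _ _ Hr) as (c & Hc & Hc').
      exists c. split; auto. intros z Hz. apply rel_opair, HG. right. exists y. split; auto.
      apply rel_opair. auto.
  - intros (g & Hr & Hg). revert x Hr. induction a as [a IH] using mem_ind. intros x Hr.
    destruct (Hg _ _ Hr) as (b & Hb & H). exists b; auto.
Qed.

Lemma def_inV {D : Type} {E : Membership D} {HD : universe_of_sets D}
    (L : Set -> Set) (I : interp L D) (X : Set) (a x : X) :
  defin (eq everything) I (fun e => inV (e a) (e x)).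
Proof.
  assert (HW : forall U : D -> Prop, everything = U -> forall x, U x)
    by (intros U <- y; exact Logic.I).
  assert (HW' : forall U : D -> Prop, everything = U -> forall x z, U x -> z ∈ x -> U z)
    by (intros U HU y z _ _; exact (HW U HU z)).
  eapply def_iff; [intros e; apply inV_witness|].
  apply def_ex; auto. apply def_and; [apply def_rel; auto|].
  apply def_all; auto. apply def_all; auto. apply def_imp; [apply def_rel; auto|].
  apply def_bex; auto. apply def_ball; auto. apply def_rel; auto.
Qed.


(** * Ultrafilters of classes *)

(** [I] is the class of the index sets for which [U] is complete. *)
Record ultrafilter {D : Type} {E : Membership D} (I : D -> Prop)
    (U : (D -> Prop) -> Prop) : Prop := {
  uf_up : forall P Q : D -> Prop, (forall x, P x -> Q x) -> U P -> U Q;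
  uf_not : forall P : D -> Prop, U (fun x => ~ P x) <-> ~ U P;
  uf_and : forall P Q : D -> Prop, U P -> U Q -> U (fun x => P x /\ Q x);
  uf_inter : forall (i : D) (P : D -> D -> Prop), I i ->
    (forall x, x ∈ i -> U (P x)) -> U (fun xi => forall x, x ∈ i -> P x xi);
  uf_nonprincipal : forall x, ~ U (fun xi => xi = x)
}.

Definition normal {D : Type} {E : Membership D} (U : (D -> Prop) -> Prop) : Prop :=
  forall h : D -> D, U (fun xi => h xi ∈ xi) -> exists c, U (fun xi => h xi = c).

Section Ultrafilter.

Context {D : Type} {E : Membership D} {I : D -> Prop} {U : (D -> Prop) -> Prop}.
Context (HU : ultrafilter I U).

Lemma uf_em (P : D -> Prop) : U P \/ U (fun x => ~ P x).
Proof. rewrite (uf_not HU). apply classic. Qed.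

Lemma uf_true (P : D -> Prop) : (forall x, P x) -> U P.
Proof. intros H. destruct (uf_em P) as [|HP]; auto. revert HP. apply (uf_up HU). auto. Qed.

Lemma uf_absurd (P : D -> Prop) : U P -> U (fun x => ~ P x) -> False.
Proof. intros H H'. apply (uf_not HU) in H'. auto. Qed.

Lemma uf_ex (P : D -> Prop) : U P -> exists x, P x.
Proof.
  intros H. apply NNPP. intros N. apply (uf_absurd H). apply uf_true. intros x Hx. eauto.
Qed.

Lemma uf_up2 (P Q S : D -> Prop) : (forall x, P x -> Q x -> S x) -> U P -> U Q -> U S.
Proof.
  intros H HP HQ. apply (uf_up HU) with (P := fun x => P x /\ Q x).
  - intros x [? ?]. auto.
  - apply (uf_and HU); auto.
Qed.

(** If every single value in [i] were avoided almost everywhere, completeness would make [h] avoid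
    all of them at once. *)
Lemma uf_const (h : D -> D) (i : D) :
  I i -> U (fun xi => h xi ∈ i) -> exists c, c ∈ i /\ U (fun xi => h xi = c).
Proof.
  intros Hi H. apply NNPP. intros N.
  assert (H' : U (fun xi => forall c, c ∈ i -> h xi <> c)).
  { apply (uf_inter HU); auto. intros c Hc. apply (uf_not HU). intros H1. apply N. eauto. }
  refine (uf_absurd H _). revert H'. apply (uf_up HU). intros xi H1 H2. exact (H1 _ H2 eq_refl).
Qed.

(** Completeness over an internal index set that contains the numerals gives it over the external
    [nat]; other members of [w] impose no condition. *)
Lemma uf_nat {HD : universe_of_sets D} (w : D) (P : nat -> D -> Prop) :
  I w -> (forall n, num n ∈ w) -> (forall n, U (P n)) -> U (fun xi => forall n, P n xi).
Proof.
  intros Hw Hn HP.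
  assert (H : U (fun xi => forall x, x ∈ w -> forall n, x = num n -> P n xi)).
  { apply (uf_inter HU); auto. intros x _.
    destruct (classic (exists n, x = num n)) as [[n ->]|N].
    - apply (uf_up HU) with (P := P n); auto. intros xi H m Hm. apply num_inj in Hm. subst. auto.
    - apply uf_true. intros xi n Hx. destruct N. eauto. }
  revert H. apply (uf_up HU). eauto.
Qed.

Lemma uf_countable {HD : universe_of_sets D} (w : D) (T : Type) (P : T -> D -> Prop) :
  I w -> (forall n, num n ∈ w) -> countable T ->
  (forall t, U (P t)) -> U (fun xi => forall t, P t xi).
Proof.
  intros Hw Hn [f Hf] HP.
  assert (H : U (fun xi => forall n t, f t = n -> P t xi)).
  { apply uf_nat with (w := w); auto. intros n.
    destruct (classic (exists t, f t = n)) as [[t Ht]|N].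
    - apply (uf_up HU) with (P := P t); auto. intros xi H t' Ht'.
      assert (t' = t) by (apply Hf; congruence). subst. auto.
    - apply uf_true. intros xi t Ht. destruct N. eauto. }
  revert H. apply (uf_up HU). eauto.
Qed.

End Ultrafilter.

(** * Normal ultrafilters on a universe of sets *)

Section Normal.

Context {D : Type} {E : Membership D} {HD : universe_of_sets D}.
Context (U : (D -> Prop) -> Prop).
Context (HU : ultrafilter (fun _ => True) U) (HN : normal U) (HO : U ordinal).

Lemma U_countable (T : Type) (P : T -> D -> Prop) :
  countable T -> (forall t, U (P t)) -> U (fun xi => forall t, P t xi).
Proof.
  apply (uf_countable HU) with (w := omega); auto. intros n. apply in_omega. eauto.
Qed.

Lemma U_mem a : ordinal a -> U (fun xi => a ∈ xi).
Proof.
  intros Oa.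
  (* The index set is [Succ a] because the value [a] has to be excluded as well. *)
  assert (H : U (fun xi => forall x, x ∈ Succ a -> xi <> x)).
  { apply (uf_inter HU); auto. intros x _. apply (uf_not HU), (uf_nonprincipal HU). }
  revert H HO. apply (uf_up2 HU). intros xi H O.
  destruct (trichotomy Oa O) as [|[<- | Hx]]; auto.
  - destruct (H a (mem_Succ a) eq_refl).
  - destruct (H xi); auto. apply in_Succ. auto.
Qed.

Lemma U_inV x : U (fun xi => inV xi x).
Proof.
  destruct (inV_exists x) as (a & Oa & Ha).
  generalize (U_mem Oa) HO. apply (uf_up2 HU). intros xi H O.
  eapply inV_mono; [|exact Ha]. exact (proj1 O a H).
Qed.

(** Normality extends from ordinals to V_xi: a level below [xi] that bounds the elements of [h xi]
    is a regressive function, hence constantly some [b]. Then [h] takes its values in the set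
    V_(b+1), where completeness applies. *)
Lemma U_regress (h : D -> D) :
  U (fun xi => inV xi (h xi)) -> exists c, U (fun xi => h xi = c).
Proof.
  intros H.
  destruct (@skolem D D) with (P := fun xi => inV xi (h xi))
    (R := fun xi b => b ∈ xi /\ forall y, y ∈ h xi -> inV b y) as [g Hg].
  - constructor. exact omega.
  - intros xi Hxi. apply inV_iff. auto.
  - destruct (HN (h := g)) as [b Hb].
    + revert H. apply (uf_up HU). apply Hg.
    + destruct (V_set (Succ b)) as [v Hv].
      destruct (uf_const HU (h := h) (i := v)) as (c & _ & Hc); eauto.
      revert H Hb. apply (uf_up2 HU). intros xi H <-. apply Hv.
      exists (g xi); [apply mem_Succ | apply Hg; auto].
Qed.

(** Diagonal intersection over assignments. Otherwise choose a counterexample in V_xi for almost all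
    [xi]; each coordinate is constant almost everywhere, and so are all the countably many
    coordinates together. This gives one fixed assignment [c] that fails almost everywhere. *)
Lemma U_diag_env (X : Set) (P : (X -> D) -> D -> Prop) :
  countable X -> (forall e, U (P e)) ->
  U (fun xi => forall e, (forall x, inV xi (e x)) -> P e xi).
Proof.
  intros HX HP. destruct (uf_em HU (fun xi => forall e, (forall x, inV xi (e x)) -> P e xi)) as [|H]; auto.
  exfalso.
  destruct (@skolem D (X -> D)) with
    (P := fun xi => ~ forall e, (forall x, inV xi (e x)) -> P e xi)
    (R := fun xi e => (forall x, inV xi (e x)) /\ ~ P e xi) as [h Hh].
  - constructor. intros _. exact omega.
  - intros xi Hxi. apply NNPP. intros N. apply Hxi. intros e He. apply NNPP. intros N'. eauto.
  - assert (Hc : forall x, exists c, U (fun xi => h xi x = c)).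
    { intros x. apply U_regress. revert H. apply (uf_up HU). intros xi Hxi. apply Hh. auto. }
    destruct (@skolem X D) with (P := fun _ : X => True)
      (R := fun x c => U (fun xi => h xi x = c)) as [c Hc']; auto.
    { constructor. exact omega. }
    assert (H1 : U (fun xi => forall x, h xi x = c x)) by (apply U_countable; auto).
    apply (uf_absurd HU (HP c)). revert H H1. apply (uf_up2 HU). intros xi H H1.
    assert (h xi = c) by (apply functional_extensionality; auto). subst c. apply Hh. auto.
Qed.

Lemma U_diag (P : D -> D -> Prop) :
  (forall s, U (P s)) -> U (fun xi => forall s, inV xi s -> P s xi).
Proof.
  intros H. generalize (U_diag_env (P := fun e : unit -> D => P (e tt)) countable_unit (fun e => H (e tt))).
  apply (uf_up HU). intros xi H' s Hs. apply (H' (fun _ => s)). auto.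
Qed.

Lemma U_limit : U limit_ordinal.
Proof.
  assert (H : U (fun xi => forall s, inV xi s -> ordinal s -> Succ s ∈ xi)).
  { apply U_diag. intros s. destruct (classic (ordinal s)) as [O|N].
    - generalize (U_mem (ordinal_Succ O)). apply (uf_up HU). auto.
    - apply (uf_true HU). tauto. }
  revert H. apply (uf_up2 HU) with (P := fun xi => ordinal xi /\ emp ∈ xi).
  - intros xi [O H0] H. apply limit_ordinal_iff. split; [|split]; auto.
    + intros ->. exact (in_emp H0).
    + intros y Hy. apply H; [apply inV_self; auto|]. exact (ordinal_elem O Hy).
  - apply (uf_and HU); auto. apply U_mem, ordinal_emp.
Qed.

(** If almost all [xi] had an unbounded function from some smaller ordinal, that ordinal would be a
    constant [a] by normality, and so would each value [c x] for [x] in [a]. A bound [b] of the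
    [c x] is below almost all [xi], a contradiction. *)
Lemma U_regular : U regular_uncountable.
Proof.
  set (B := fun xi => forall a f, a ∈ xi -> is_function f a xi ->
    exists b, b ∈ xi /\ forall x y, rel f x y -> y ∈ b).
  assert (H : U B).
  { destruct (uf_em HU B) as [|H]; auto. exfalso.
    destruct (@skolem D (D * D)) with (P := fun xi => ~ B xi)
      (R := fun xi p => fst p ∈ xi /\ is_function (snd p) (fst p) xi /\
        ~ exists b, b ∈ xi /\ forall x y, rel (snd p) x y -> y ∈ b) as [h Hh].
    { constructor. exact (omega, omega). }
    { intros xi Hxi. apply NNPP. intros N. apply Hxi. intros a f Ha Hf. apply NNPP. intros N'.
      apply N. exists (a, f). auto. }
    destruct (HN (h := fun xi => fst (h xi))) as [a Ha].
    { revert H. apply (uf_up HU). intros xi Hxi. apply Hh. auto. }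
    destruct (@skolem D (D -> D)) with (P := fun xi => ~ B xi)
      (R := fun xi v => forall x, x ∈ fst (h xi) -> rel (snd (h xi)) x (v x)) as [v Hv].
    { constructor. intros _. exact omega. }
    { intros xi Hxi. destruct (skolem (inhabits omega) (fun x => x ∈ fst (h xi))
        (fun x y => rel (snd (h xi)) x y)) as [v Hv]; eauto.
      intros x Hx. destruct (Hh xi Hxi) as (_ & [_ Hf] & _). destruct (Hf x Hx) as (y & Hy & _). eauto. }
    assert (Hin : forall xi, ~ B xi -> forall x y, rel (snd (h xi)) x y ->
      x ∈ fst (h xi) /\ y ∈ xi /\ y = v xi x).
    { intros xi Hxi x y Hr. destruct (Hh xi Hxi) as (_ & [Hf1 Hf2] & _).
      destruct (Hf1 _ (proj1 (rel_opair _ _ _) Hr)) as (x' & y' & Hp & Hx & Hy).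
      apply is_opair_eq, opair_inj in Hp as [<- <-]. split; [|split]; auto.
      destruct (Hf2 x Hx) as (z & _ & Hz). rewrite <- (Hz y Hr). apply Hz, Hv; auto. }
    destruct (skolem (inhabits omega) (fun x => x ∈ a)
      (fun x c => ordinal c /\ U (fun xi => v xi x = c))) as [c Hc].
    { intros x Hx. assert (Hvx : U (fun xi => v xi x ∈ xi)).
      { revert H Ha. apply (uf_up2 HU). intros xi Hxi <-. apply Hin with (x := x); auto. }
      destruct (HN Hvx) as [c Hc]. exists c. split; auto.
      destruct (uf_ex HU (uf_and HU HO (uf_and HU Hc Hvx))) as (xi & O & <- & Hxi).
      exact (ordinal_elem O Hxi). }
    destruct (ordinal_bound (F := c) (x := a)) as (b & Ob & Hb); [apply Hc|].
    assert (Hall : U (fun xi => forall x, x ∈ a -> v xi x = c x))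
      by (apply (uf_inter HU); auto; apply Hc).
    destruct (uf_ex HU (uf_and HU (uf_and HU H (U_mem Ob)) (uf_and HU Ha Hall)))
      as (xi & [Hxi Hbx] & <- & Hvc).
    apply (Hh xi Hxi). exists b. split; auto. intros x y Hr.
    destruct (Hin xi Hxi x y Hr) as (Hx & _ & ->). rewrite Hvc; auto. }
  generalize (uf_and HU HO H) (U_mem (proj1 (proj1 is_omega_omega))).
  apply (uf_up2 HU). clear H. intros xi [O H] Hw. split; [split; [split|]|]; auto.
  (* Regularity implies being a cardinal: a surjection from a smaller ordinal would be bounded. *)
  - intros a f Ha Hf Hs. destruct (H a f Ha Hf) as (b & Hb & Hr). destruct (Hs b Hb) as (x & _ & Hx).
    apply (mem_irrefl (Hr x b Hx)).
  - exists omega. split; auto. exact is_omega_omega.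
Qed.

(** The reflection principle by the Tarski-Vaught test: a witness for a given assignment lies in
    V_mu for almost all [mu], and the diagonal intersection handles all assignments in V_mu. *)
Lemma U_elementary (L : Set -> Set) (I : interp L D) (X : Set) (p : formula L X) :
  countable X ->
  U (fun mu => forall e, (forall x, inV mu (e x)) ->
    (sat (inV mu) I e p <-> sat everything I e p)).
Proof.
  induction p as [X x y|X x y|X a|X p IH|X p IHp q IHq|X p IHp q IHq|X p IHp q IHq|X p IH|X p IH];
    intros HX; simpl.
  - apply (uf_true HU). tauto.
  - apply (uf_true HU). tauto.
  - apply (uf_true HU). tauto.
  - generalize (IH HX). apply (uf_up HU). intros mu H e He. rewrite (H e He). tauto.
  - generalize (IHp HX) (IHq HX). apply (uf_up2 HU). intros mu Hp Hq e He.
    rewrite (Hp e He), (Hq e He). tauto.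
  - generalize (IHp HX) (IHq HX). apply (uf_up2 HU). intros mu Hp Hq e He.
    rewrite (Hp e He), (Hq e He). tauto.
  - generalize (IHp HX) (IHq HX). apply (uf_up2 HU). intros mu Hp Hq e He.
    rewrite (Hp e He), (Hq e He). tauto.
  - assert (H : U (fun mu => forall e : X -> D, (forall x, inV mu (e x)) ->
        (exists d, ~ sat everything I (extend e d) p) ->
        exists d, inV mu d /\ ~ sat everything I (extend e d) p)).
    { apply U_diag_env; auto. intros e.
      destruct (classic (exists d, ~ sat everything I (extend e d) p)) as [[d Hd]|N].
      - generalize (U_inV d). apply (uf_up HU). eauto.
      - apply (uf_true HU). tauto. }
    generalize (IH (countable_option HX)) H. apply (uf_up2 HU). clear H. intros mu Hp H e He.
    assert (Hp' : forall d, inV mu d -> (sat (inV mu) I (extend e d) p <-> sat everything I (extend e d) p))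
      by (intros d Hd; apply Hp; intros [x|]; simpl; auto).
    split.
    + intros Hs d _. apply NNPP. intros N. destruct (H e He) as (d' & Hd' & N'); eauto.
      apply N', Hp'; auto.
    + intros Hs d Hd. apply Hp'; auto. apply Hs. exact Logic.I.
  - assert (H : U (fun mu => forall e : X -> D, (forall x, inV mu (e x)) ->
        (exists d, sat everything I (extend e d) p) ->
        exists d, inV mu d /\ sat everything I (extend e d) p)).
    { apply U_diag_env; auto. intros e.
      destruct (classic (exists d, sat everything I (extend e d) p)) as [[d Hd]|N].
      - generalize (U_inV d). apply (uf_up HU). eauto.
      - apply (uf_true HU). tauto. }
    generalize (IH (countable_option HX)) H. apply (uf_up2 HU). clear H. intros mu Hp H e He.
    assert (Hp' : forall d, inV mu d -> (sat (inV mu) I (extend e d) p <-> sat everything I (extend e d) p))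
      by (intros d Hd; apply Hp; intros [x|]; simpl; auto).
    split.
    + intros (d & Hd & Hs). exists d. split; [exact Logic.I|]. apply Hp'; auto.
    + intros (d & _ & Hs). destruct (H e He) as (d' & Hd' & Hs'); eauto.
      exists d'. split; auto. apply Hp'; auto.
Qed.

(** The right-hand side is the average type of [U] over V_a, that is, the type of the generic point;
    [a] is required to realize it. *)
Definition reflects (P : D -> Prop) (a : D) : Prop :=
  forall (p : formula L1 bool) (s : D), inV a s ->
    (sat everything (I1 P) (pair_assignment a s) p <->
     U (fun xi => sat everything (I1 P) (pair_assignment xi s) p)).

(** For fixed [p] and [s], either [p] or its negation holds almost everywhere, and where the
    majority value is taken the equivalence holds. *)
Lemma U_reflects (P : D -> Prop) : U (reflects P).
Proof.
  apply U_countable; [apply countable_formula1, countable_bool |].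
  intros p. apply U_diag. intros s.
  destruct (uf_em HU (fun xi => sat everything (I1 P) (pair_assignment xi s) p)) as [H|H].
  - generalize H. apply (uf_up HU). tauto.
  - generalize H. apply (uf_not HU) in H. apply (uf_up HU). tauto.
Qed.

Lemma reflects_elementary (P : D -> Prop) (b : D) :
  limit_ordinal b -> reflects P b ->
  forall (p : formula L1 bool) (u v : D), inV b u -> inV b v ->
    (sat (inV b) (I1 P) (pair_assignment u v) p <->
     sat everything (I1 P) (pair_assignment u v) p).
Proof.
  intros Lb H p u v Hu Hv.
  assert (HW : forall V : D -> Prop, everything = V -> forall x, V x)
    by (intros V <- y; exact Logic.I).
  assert (HW' : forall V : D -> Prop, everything = V -> forall x z, V x -> z ∈ x -> V z)
    by (intros V HV y z _ _; exact (HW V HV z)).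
  (* [reflects] grants one parameter, so the pair is passed as one set and [Q] decodes it; [true]
     names the level, [false] the pair. *)
  set (Q := fun e : bool -> D => forall u v, is_opair (e false) u v ->
    (sat (inV (e true)) (I1 P) (pair_assignment u v) p <->
     sat everything (I1 P) (pair_assignment u v) p)).
  assert (HQ : defin (eq everything) (I1 P) Q).
  { set (f := fun b : bool => if b then Some None else None : option (option bool)).
    assert (Hf : forall e : option (option bool) -> D,
      pair_assignment (e (Some None)) (e None) = (fun x => e (f x)))
      by (intros e; apply functional_extensionality; intros []; auto).
    unfold Q. apply def_all; auto. apply def_all; auto.
    apply def_imp; [apply def_opair; auto|]. apply def_equiv.
    - refine (def_iff _ (def_sat (P := P) (N := inV) _ p f (Some (Some true)))).
      + intros e. rewrite Hf. reflexivity.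
      + intros. apply def_inV.
    (* Truth in [D] is treated as relativization to the class x = x, so that both sides are formulas
       in the same context. *)
    - refine (def_iff _ (def_sat (P := P) (N := fun _ => everything) _ p f (Some (Some true)))).
      + intros e. rewrite Hf. reflexivity.
      + intros Y z x. exists (Equal x x). simpl. unfold everything. tauto. }
  destruct HQ as [q Hq].
  assert (Hb : Q (pair_assignment b (opair u v))).
  { apply (Hq everything eq_refl); [intros; exact Logic.I|].
    apply H; [apply inV_opair; auto|].
    generalize (U_elementary (I1 P) p countable_bool) (U_inV (opair u v)).
    intros H1 H2. generalize (uf_and HU H1 H2) HO. clear H1 H2.
    apply (uf_up2 HU). intros xi [He Hi] O.
    apply (Hq everything eq_refl); [intros; exact Logic.I|].
    intros u' v' Hp. simpl in *. apply is_opair_eq, opair_inj in Hp as [<- <-]. apply He.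
    destruct (inV_opair_inv (proj1 O) Hi). intros []; auto. }
  apply Hb. simpl. apply is_opair_eq. reflexivity.
Qed.

(** * The reflective ordinals *)

(** One clause over all [m] below [n] covers zero, successors and limits together. *)
Definition reflective : D -> D -> Prop :=
  Fix mem_wf (fun _ => D -> Prop) (fun n rec a =>
    ordinal n /\ regular_uncountable a /\
    forall m (Hm : m ∈ n), rec m Hm a /\ reflects (rec m Hm) a).

Lemma reflective_iff n a :
  reflective n a <-> ordinal n /\ regular_uncountable a /\
    forall m, m ∈ n -> reflective m a /\ reflects (reflective m) a.
Proof.
  unfold reflective at 1. rewrite Fix_eq; [reflexivity|].
  intros x f g H. assert (f = g) as ->; auto.
  apply functional_extensionality_dep. intros y. apply functional_extensionality_dep. auto.
Qed.

Lemma U_reflective n : ordinal n -> U (reflective n).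
Proof.
  induction n as [n IH] using mem_ind. intros O.
  assert (H : U (fun a => forall m, m ∈ n -> reflective m a /\ reflects (reflective m) a)).
  { apply (uf_inter HU); auto. intros m Hm. apply (uf_and HU).
    - apply IH; auto. exact (ordinal_elem O Hm).
    - apply U_reflects. }
  generalize H U_regular. apply (uf_up2 HU). intros a Ha Hr. apply reflective_iff. auto.
Qed.

(** A diagonal intersection over [n]. It yields both the witnesses for B8 and the condition on the
    diagonal that singles out the predicate. *)
Lemma U_reflective_diag : U (fun xi => reflective xi xi).
Proof.
  assert (H : U (fun xi => forall n, inV xi n -> ordinal n ->
    reflective n xi /\ reflects (reflective n) xi)).
  { apply U_diag. intros n. destruct (classic (ordinal n)) as [O|N].
    - generalize (U_reflective O) (U_reflects (reflective n)). apply (uf_up2 HU). auto.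
    - apply (uf_true HU). tauto. }
  generalize (uf_and HU H U_regular) HO. apply (uf_up2 HU). intros xi [Hxi Hr] O.
  apply reflective_iff. split; [|split]; auto. intros m Hm. apply Hxi.
  - apply inV_self; auto.
  - exact (ordinal_elem O Hm).
Qed.

Lemma reflective_Succ n a :
  ordinal n -> (reflective (Succ n) a <-> reflective n a /\ reflects (reflective n) a).
Proof.
  intros O. split.
  - intros H. apply reflective_iff in H as (_ & _ & H). apply H, mem_Succ.
  - intros [H H']. pose proof H as H0. apply reflective_iff in H0 as (_ & Hr & H0).
    apply reflective_iff. split; [|split]; auto using ordinal_Succ.
    intros m Hm. apply in_Succ in Hm as [Hm | ->]; auto.
Qed.

Lemma reflective_limit_ordinal n a : reflective n a -> limit_ordinal a.
Proof. intros H. apply reflective_iff in H. apply regular_limit. tauto. Qed.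

(** Elementarity of V_b and V_c moves both sides to [D], where [p(b, s)] has the generic value
    because [b] reflects. The condition of B7 thus says exactly that [a] reflects. *)
Lemma reflective_B7 : B7 reflective.
Proof.
  intros n n1 a b c On Hn1 Oa Hb Hc Ha Hab Hbc. apply is_succ_eq in Hn1. subst n1.
  assert (Lb := reflective_limit_ordinal Hb). assert (Lc := reflective_limit_ordinal Hc).
  apply reflective_Succ in Hb as [Rb Hb], Hc as [Rc Hc]; auto.
  assert (Va : inV b a) by (apply inV_self; auto; apply Lb).
  assert (Vb : inV c b) by (apply inV_self; auto; apply Lc).
  assert (Sab : subset a b) by (apply (proj1 (proj1 Lb)); auto).
  assert (Sbc : subset b c) by (apply (proj1 (proj1 Lc)); auto).
  assert (H : forall p s, inV a s ->
    ((sat (inV b) (I1 (reflective n)) (pair_assignment a s) p <->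
      sat (inV c) (I1 (reflective n)) (pair_assignment b s) p) <->
     (sat everything (I1 (reflective n)) (pair_assignment a s) p <->
      U (fun xi => sat everything (I1 (reflective n)) (pair_assignment xi s) p)))).
  { intros p s Hs.
    assert (Hs' : inV b s) by (eapply inV_mono; eauto).
    rewrite (reflects_elementary Lb Hb), (reflects_elementary Lc Hc), (Hb p s Hs'); auto.
    - reflexivity.
    - eapply inV_mono; eauto. }
  rewrite reflective_Succ; auto. split.
  - intros [_ Hra] p s Hs. apply H; auto.
  - intros Hra. assert (Hra' : reflects (reflective n) a) by (intros p s Hs; apply H; auto).
    split; auto. 
    (* It remains to show R_n(a). The atomic formula for R_n is generically true, so [a] inherits
       it; the element [s] only fills the parameter slot. *)
    destruct (nonempty (x := a)) as [s Hs]; [rewrite <- is_empty_eq; auto|].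
    apply (Hra' (Pred (true : L1 bool)) s); [apply inV_self; auto|].
    exact (U_reflective On).
Qed.

(** Almost all [mu] are correct for every formula simultaneously, whatever its complexity. *)
Lemma reflective_B8 : B8 reflective.
Proof.
  intros m.
  assert (H : U (fun mu => forall (p : formula L2 unit) e, (forall x, inV mu (e x)) ->
    (sat (inV mu) (I2 reflective) e p <-> sat everything (I2 reflective) e p))).
  { apply U_countable; [apply countable_formula2, countable_unit|].
    intros p. apply U_elementary, countable_unit. }
  destruct (uf_ex HU (uf_and HU H U_reflective_diag)) as (mu & He & Hr).
  exists mu. split; [|split]; auto.
  - apply reflective_iff in Hr as (_ & [[Hc _] _] & _). auto.
  - intros p s _ Hs. apply He. auto.
Qed.

End Normal.


(** * Existence and uniqueness of the predicate over a universe of sets *)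

Section Uniqueness.

Context {D : Type} {E : Membership D} {HD : universe_of_sets D}.
Context (U : (D -> Prop) -> Prop).
Context (HU : ultrafilter (fun _ => True) U) (HN : normal U) (HO : U ordinal).

Lemma reflective_satisfies : satisfies_B1_B8 (reflective U).
Proof.
  split; [|split; [|split; [|split; [|split; [|split; [|split]]]]]].
  - destruct HD. split; auto.
  - intros x. exists (sep x (fun p => exists y z, is_opair p y z /\ reflective U y z)).
    intros p. rewrite in_sep. reflexivity.
  - intros y z H. apply reflective_iff in H as (O & Hr & _). split; auto. apply Hr.
  - intros n x Hn. apply is_empty_eq in Hn. subst n. rewrite reflective_iff. split; [tauto|].
    intros H. split; [|split]; auto using ordinal_emp. intros m Hm. destruct (in_emp Hm).
  - intros n n1 a Hn1 H. apply reflective_iff in H as (_ & _ & H). apply H, Hn1. auto.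
  - intros n a Ln. split.
    + intros H m Hm. apply reflective_iff in H as (_ & _ & H). apply H. auto.
    + intros H. pose proof Ln as Ln'. apply limit_ordinal_iff in Ln' as (O & Hn & HS).
      apply reflective_iff. split; [|split]; auto.
      * destruct (nonempty Hn) as [m Hm]. apply H, reflective_iff in Hm. tauto.
      (* Reflection at [m] is read off from membership at [Succ m], which is still below the
         limit. *)
      * intros m Hm. apply reflective_Succ; auto. exact (ordinal_elem O Hm).
  - exact (reflective_B7 HU HN HO).
  - exact (reflective_B8 HU HN HO).
Qed.

Lemma reflective_unique (R : D -> D -> Prop) :
  satisfies_B1_B8 R -> U (fun xi => R xi xi) -> R = reflective U.
Proof.
  intros (_ & _ & H3 & H4 & H5 & H6 & H7 & _) HR.
  (* At a limit [xi], B6 spreads R(xi, xi) down to R(n, xi) for all [n] below [xi]. *)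
  assert (HRn : forall n, ordinal n -> U (R n)).
  { intros n O. generalize (uf_and HU HR (U_mem HU HO O)) (U_limit HU HN HO).
    apply (uf_up2 HU). intros xi [Hxi Hn] L. exact (proj1 (H6 _ _ L) Hxi n Hn). }
  assert (Heq : forall n, R n = reflective U n).
  { induction n as [n IH] using mem_ind. apply functional_extensionality. intros a.
    apply propositional_extensionality.
    destruct (classic (ordinal n)) as [O|N];
      [| split; intros H; destruct N; [apply H3 in H | apply reflective_iff in H]; tauto].
    destruct reflective_satisfies as (_ & _ & _ & B4' & _ & B6' & _).
    destruct (ordinal_cases O) as [-> | [(m & Om & ->)| L]].
    - rewrite (H4 emp a), (B4' emp a); [reflexivity | intros z; apply in_emp | intros z; apply in_emp].
    - specialize (IH m (mem_Succ m)). rewrite (reflective_Succ _ _ Om).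
      assert (HS : forall x, R (Succ m) x -> R m x) by (intros x; apply H5, is_succ_eq; auto).
      (* The hypothesis makes [a] a limit ordinal, in particular a nonzero ordinal, as B7
         demands. *)
      assert (Hred : reflective U m a ->
        (R (Succ m) a <-> reflects U (reflective U m) a)).
      { intros Ha. pose proof (reflective_limit_ordinal Ha) as La.
        assert (Hgen : U (fun b => (forall (p : formula L1 bool) e, (forall x, inV b (e x)) ->
            (sat (inV b) (I1 (reflective U m)) e p <-> sat everything (I1 (reflective U m)) e p))
            /\ reflects U (reflective U m) b)).
        { apply (uf_and HU).
          - apply (U_countable HU); [apply countable_formula1, countable_bool|].
            intros p. apply (U_elementary HU HN HO), countable_bool.
          - apply (U_reflects HU HN). }
        (* Generic members of R_(m+1) exist above any ordinal; two applications supply [b] above [a]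
           and [c] above [b] for B7. *)
        assert (Hch : forall x, ordinal x -> exists b, x ∈ b /\ R (Succ m) b /\ ordinal b /\
          (forall (p : formula L1 bool) e, (forall x, inV b (e x)) ->
            (sat (inV b) (I1 (reflective U m)) e p <-> sat everything (I1 (reflective U m)) e p))
          /\ reflects U (reflective U m) b).
        { intros x Ox.
          destruct (uf_ex HU (uf_and HU (uf_and HU (U_mem HU HO Ox) (HRn _ (ordinal_Succ Om)))
            (uf_and HU HO Hgen))) as (b & [Hb1 Hb2] & Hb3 & Hb4 & Hb5).
          exists b. tauto. }
        destruct (Hch a (proj1 La)) as (b & Hab & Rb & Ob & Eb & Fb).
        destruct (Hch b Ob) as (c & Hbc & Rc & Oc & Ec & Fc).
        assert (Hpa : forall c x s, inV c x -> inV c s -> forall v, inV c (pair_assignment x s v))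
          by (intros ? ? ? ? ? []; auto).
        rewrite (H7 m (Succ m) a b c); auto; try (apply is_succ_eq; reflexivity); try apply La.
        assert (H : forall p s, inV a s ->
          ((sat (inV b) (I1 (R m)) (pair_assignment a s) p <->
            sat (inV c) (I1 (R m)) (pair_assignment b s) p) <->
           (sat everything (I1 (reflective U m)) (pair_assignment a s) p <->
            U (fun xi => sat everything (I1 (reflective U m)) (pair_assignment xi s) p)))).
        { intros p s Hs.
          assert (Hbs : inV b s) by (apply (inV_mono (proj1 Ob a Hab) Hs)).
          assert (Hcs : inV c s) by (apply (inV_mono (proj1 Oc b Hbc) Hbs)).
          rewrite IH, Eb, Ec, (Fb p s Hbs); [reflexivity | |];
            apply Hpa; auto; apply inV_self; auto. }
        split; intros H' p s Hs; apply H; auto. }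
      split.
      + intros H. assert (Ha : reflective U m a) by (rewrite <- IH; auto). split; auto.
        apply Hred; auto.
      + intros [Ha H]. apply Hred; auto.
    - rewrite (H6 n a L), (B6' n a L). split; intros H m Hm; [rewrite <- IH | rewrite IH]; auto. }
  apply functional_extensionality. exact Heq.
Qed.

End Uniqueness.

(** * The universe [V_k] *)

Section Rank.

Context {V : Type} {E : Membership V} {HV : universe_of_sets V}.
Context (k : V) (Ul : (V -> Prop) -> Prop).
Context (Lk : limit_ordinal k) (Hw : omega ∈ k).
Context (HU : ultrafilter (fun i => i ∈ k) Ul) (HN : normal Ul) (HK : Ul (fun xi => xi ∈ k)).

Notation D := {x : V | inV k x}.

Lemma Tk : transitive k.
Proof. exact (proj1 (proj1 Lk)). Qed.

Lemma Ul_mem a : a ∈ k -> Ul (fun xi => a ∈ xi).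
Proof.
  intros Ha. assert (O : ordinal k) by apply Lk.
  assert (H : Ul (fun xi => forall x, x ∈ Succ a -> xi <> x)).
  { apply (uf_inter HU).
    - apply limit_ordinal_iff in Lk as (_ & _ & HS). auto.
    - intros x _. apply (uf_not HU), (uf_nonprincipal HU). }
  revert H HK. apply (uf_up2 HU). intros xi H Hxi.
  destruct (trichotomy (ordinal_elem O Ha) (ordinal_elem O Hxi)) as [|[<- | Hx]]; auto.
  - destruct (H a (mem_Succ a) eq_refl).
  - destruct (H xi); auto. apply in_Succ. auto.
Qed.

(** Completeness for families indexed by subsets of [V_b] follows from the constancy
    of functions into [V_b], as [U] decides each element of the values. *)
Lemma Ul_const_rank a :
  a ∈ k -> forall h, Ul (fun xi => inV a (h xi)) -> exists c, Ul (fun xi => h xi = c).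
Proof.
  induction a as [a IH] using mem_ind. intros Ha h H.
  destruct (skolem (inhabits emp) (fun xi => inV a (h xi))
    (fun xi b => b ∈ a /\ forall y, y ∈ h xi -> inV b y)) as [g Hg].
  { intros xi Hxi. apply inV_iff. auto. }
  destruct (uf_const HU (h := g) (i := a)) as (b & Hb & Hgb); auto.
  { revert H. apply (uf_up HU). apply Hg. }
  assert (Hbk : b ∈ k) by exact (Tk Ha Hb).
  assert (Hinter : forall P : V -> V -> Prop, (forall y, inV b y -> Ul (P y)) ->
    Ul (fun xi => forall y, inV b y -> P y xi)).
  { intros P HP. destruct (uf_em HU (fun xi => forall y, inV b y -> P y xi)) as [|N]; auto.
    exfalso. destruct (skolem (inhabits emp) (fun xi => ~ forall y, inV b y -> P y xi)
      (fun xi y => inV b y /\ ~ P y xi)) as [f Hf].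
    { intros xi Hxi. apply NNPP. intros N'. apply Hxi. intros y Hy. apply NNPP. eauto. }
    destruct (IH b Hb Hbk f) as [c Hc].
    { revert N. apply (uf_up HU). apply Hf. }
    destruct (uf_ex HU (uf_and HU N Hc)) as (xi0 & Hxi0 & Hc0).
    assert (Hcb : inV b c) by (rewrite <- Hc0; apply Hf; auto).
    destruct (uf_ex HU (uf_and HU (HP c Hcb) (uf_and HU N Hc))) as (xi & Hxi & Nxi & <-).
    destruct (Hf xi Nxi). auto. }
  destruct (V_set b) as [v Hv].
  (* The constant value consists of the [y] that belong to [h xi] for almost all [xi]. *)
  exists (sep v (fun y => Ul (fun xi => y ∈ h xi))).
  assert (Hdec : Ul (fun xi => forall y, inV b y -> (y ∈ h xi <-> Ul (fun xi => y ∈ h xi)))).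
  { apply Hinter. intros y _. destruct (uf_em HU (fun xi => y ∈ h xi)) as [Hy|Hy].
    - generalize Hy. apply (uf_up HU). tauto.
    - generalize Hy. apply (uf_not HU) in Hy. apply (uf_up HU). tauto. }
  revert Hdec. generalize (uf_and HU Hgb H). apply (uf_up2 HU). intros xi [<- Hxi] Hdec.
  apply set_ext. intros z. rewrite in_sep, Hv. split.
  - intros Hz. assert (Hz' : inV (g xi) z) by (apply Hg; auto). split; auto. apply Hdec; auto.
  - intros [Hz HUz]. apply Hdec; auto.
Qed.

Lemma Ul_const x h : inV k x -> Ul (fun xi => h xi ∈ x) ->
  exists c, c ∈ x /\ Ul (fun xi => h xi = c).
Proof.
  intros [a Ha Hx] H. destruct (Ul_const_rank Ha (h := h)) as [c Hc].
  { revert H. apply (uf_up HU). auto. }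
  exists c. split; auto. destruct (uf_ex HU (uf_and HU H Hc)) as (xi & Hxi & <-). auto.
Qed.

Lemma Ul_inter x (P : V -> V -> Prop) : inV k x -> (forall y, y ∈ x -> Ul (P y)) ->
  Ul (fun xi => forall y, y ∈ x -> P y xi).
Proof.
  intros Hx HP. destruct (uf_em HU (fun xi => forall y, y ∈ x -> P y xi)) as [|N]; auto.
  exfalso. destruct (skolem (inhabits emp) (fun xi => ~ forall y, y ∈ x -> P y xi)
    (fun xi y => y ∈ x /\ ~ P y xi)) as [f Hf].
  { intros xi Hxi. apply NNPP. intros N'. apply Hxi. intros y Hy. apply NNPP. eauto. }
  destruct (Ul_const (h := f) Hx) as (c & Hcx & Hc).
  { revert N. apply (uf_up HU). apply Hf. }
  destruct (uf_ex HU (uf_and HU (HP c Hcx) (uf_and HU N Hc))) as (xi & Hxi & Nxi & <-).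
  destruct (Hf xi Nxi). auto.
Qed.

Lemma rank_eq (x y : D) : proj1_sig x = proj1_sig y -> x = y.
Proof.
  destruct x as [x Hx], y as [y Hy]. simpl. intros <-. f_equal. apply proof_irrelevance.
Qed.

Lemma rank_ordinal (x : D) : ordinal (proj1_sig x) -> ordinal x.
Proof.
  intros [H1 H2]. split.
  - intros y Hy z Hz. exact (H1 _ Hy _ Hz).
  - intros y Hy z Hz t Ht. exact (H2 _ Hy _ Hz _ Ht).
Qed.

(** The inaccessibility of [k] as Replacement uses it. If every level [b] misses some [F u], the
    choice of [u] as a function of [b] is constant almost everywhere; but that one [F u] lies in
    V_xi for almost all [xi]. *)
Lemma inV_bounded_family x (F : V -> V) : inV k x -> (forall u, u ∈ x -> inV k (F u)) ->
  exists b, b ∈ k /\ forall u, u ∈ x -> inV b (F u).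
Proof.
  intros Hx HF. assert (O : ordinal k) by apply Lk.
  apply NNPP. intros N.
  destruct (skolem (inhabits emp) (fun b => b ∈ k) (fun b u => u ∈ x /\ ~ inV b (F u))) as [h Hh].
  { intros b Hb. apply NNPP. intros N'. apply N. exists b. split; auto. intros u Hu.
    apply NNPP. intros N2. apply N'. eauto. }
  destruct (Ul_const (h := h) Hx) as (u & Hu & Hc).
  { revert HK. apply (uf_up HU). apply Hh. }
  destruct (HF u Hu) as [b Hb HFu].
  destruct (uf_ex HU (uf_and HU HK (uf_and HU Hc (Ul_mem Hb)))) as (xi & Hxi & <- & Hbxi).
  destruct (Hh xi Hxi) as [_ N']. apply N'. exists b; auto.
Qed.

(** Subsets of elements of V_k are again in V_k, so Separation for arbitrary predicates on [D] comes
    from [V]. The ultrafilter enters in Replacement, through the bound on the values. *)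
Lemma rank_universe : universe_of_sets D.
Proof.
  assert (O : ordinal k) by apply Lk.
  destruct (proj1 (limit_ordinal_iff _) Lk) as (_ & _ & HS).
  assert (Hin : forall (x : D) z, z ∈ proj1_sig x -> inV k z)
    by (intros [x Hx] z Hz; exact (inV_trans Tk Hz Hx)).
  split.
  - intros x y H. apply rank_eq, set_ext. intros z. split; intros Hz.
    + exact (proj1 (H (exist _ z (Hin _ _ Hz))) Hz).
    + exact (proj2 (H (exist _ z (Hin _ _ Hz))) Hz).
  - intros x H. destruct (foundation HV (x := proj1_sig x)) as (y & Hy & Hmin).
    + intros N. apply H. intros z Hz. exact (N _ Hz).
    + exists (exist _ y (Hin _ _ Hy)). split; auto. intros z Hz. exact (Hmin _ Hz).
  - intros x y. exists (exist _ _ (inV_upair Lk (proj2_sig x) (proj2_sig y))).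
    intros z. unfold mem, mem_sub. simpl. fold (mem (D := V)). rewrite in_upair.
    split; (intros [H|H]; [left|right]); try (apply rank_eq, H); congruence.
  - intros x. assert (H : inV k (Union (proj1_sig x))).
    { destruct x as [x [b Hb Hx]]. exists b; auto. simpl. intros z Hz.
      apply in_Union in Hz as (y & Hy & Hz).
      exact (inV_trans (proj1 (ordinal_elem O Hb)) Hz (Hx y Hy)). }
    exists (exist _ _ H). intros z. unfold mem, mem_sub. simpl. rewrite in_Union. split.
    + intros (y & Hy & Hz). exists (exist _ y (Hin _ _ Hy)). auto.
    + intros (y & Hy & Hz). exists (proj1_sig y). auto.
  - intros x. assert (H : inV k (pow (proj1_sig x))).
    { destruct x as [x [b Hb Hx]]. exists (Succ b); auto. simpl. intros z Hz.
      rewrite in_pow in Hz. exists b; auto using mem_Succ. }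
    exists (exist _ _ H). intros z. unfold mem at 1, mem_sub at 1. simpl. rewrite in_pow. split.
    + intros Hz y Hy. exact (Hz _ Hy).
    + intros Hz y Hy. exact (Hz (exist _ y (Hin _ _ Hy)) Hy).
  - exists (exist _ _ (inV_self O Hw)). split.
    + assert (He : inV k emp) by (apply inV_self; auto; apply (limit_num 0); auto).
      exists (exist _ _ He). split.
      * intros z Hz. exact (in_emp Hz).
      * apply in_omega. exists 0. auto.
    + intros x Hx. change (proj1_sig x ∈ omega) in Hx. apply in_omega in Hx as [n Hn].
      exists (exist _ _ (inV_self O (limit_num (S n) Lk))). split.
      * intros z. change (proj1_sig z ∈ Succ (num n) <-> proj1_sig z ∈ proj1_sig x \/ z = x).
        rewrite in_Succ, <- Hn.
        split; (intros [H|H]; [left|right]); auto; [apply rank_eq, H | congruence].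
      * apply in_omega. exists (S n). auto.
  - intros P _ x.
    set (s := sep (proj1_sig x) (fun z => exists H, P (exist _ z H))).
    assert (Hs : inV k s).
    { apply inV_subset with (x := proj1_sig x); [|apply proj2_sig]. intros z Hz.
      apply in_sep in Hz. tauto. }
    exists (exist _ s Hs). intros z. unfold mem, mem_sub. simpl. unfold s. rewrite in_sep. split.
    + intros (Hz & H & HP). split; auto. 
      replace z with (exist (fun x => inV k x) (proj1_sig z) H); auto. apply rank_eq. auto.
    + intros (Hz & HP). split; auto. exists (proj2_sig z). destruct z. auto.
  - intros F _ x HF.
    destruct (skolem (inhabits emp) (fun u => u ∈ proj1_sig x)
      (fun u v => exists Hu Hv, F (exist _ u Hu) (exist _ v Hv))) as [f Hf].
    { intros u Hu. destruct (HF (exist _ u (Hin _ _ Hu)) Hu) as ([v Hv] & HFv & _). eauto. }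
    destruct (@inV_bounded_family (proj1_sig x) f) as (b & Hb & Hbf).
    { apply proj2_sig. }
    { intros u Hu. destruct (Hf u Hu) as (_ & Hv & _). auto. }
    assert (Hs : inV k (img f (proj1_sig x))).
    { exists b; auto. intros y Hy. apply in_img in Hy as (u & Hu & ->). auto. }
    exists (exist _ _ Hs). intros v. unfold mem, mem_sub. simpl. rewrite in_img. split.
    + intros (u & Hu & Hv). destruct (Hf u Hu) as (Hu' & Hv' & HFu).
      exists (exist _ u Hu'). split; auto.
      replace v with (exist (fun x => inV k x) (f u) Hv'); auto. apply rank_eq. auto.
    + intros (u & Hu & HFu). exists (proj1_sig u). split; auto.
      destruct (Hf _ Hu) as (Hu' & Hv' & HFu').
      destruct (HF u Hu) as (w & _ & Hw').
      assert (Heq : exist _ (proj1_sig u) Hu' = u) by (apply rank_eq; auto). rewrite Heq in HFu'.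
      rewrite (Hw' _ HFu') in Hw'. rewrite <- (Hw' _ HFu). auto.
  - intros x Hne Hdis. destruct (Defs.choice HV (proj1_sig x)) as [c Hc].
    + intros y Hy He. apply (Hne (exist _ y (Hin _ _ Hy)) Hy). intros z Hz. exact (He _ Hz).
    + intros y z Hy Hz (t & Hty & Htz).
      assert (H : exist _ y (Hin _ _ Hy) = exist _ z (Hin _ _ Hz)).
      { apply Hdis; auto. exists (exist _ t (inV_trans Tk Hty (Hin _ _ Hy))). auto. }
      injection H. auto.
    + set (s := sep (Union (proj1_sig x)) (fun t => t ∈ c)).
      assert (Hs : inV k s).
      { destruct x as [x [b Hb Hx]]. exists b; auto. simpl in *. intros z Hz.
        apply in_sep in Hz as [Hz _]. apply in_Union in Hz as (y & Hy & Hz).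
        exact (inV_trans (proj1 (ordinal_elem O Hb)) Hz (Hx y Hy)). }
      exists (exist _ s Hs). intros y Hy. destruct (Hc _ Hy) as (t & [Ht1 Ht2] & Hu).
      exists (exist _ t (Hin _ _ Ht1)). split; [split|]; auto.
      * apply in_sep. split; auto. apply in_Union. eauto.
      * intros t' [Ht' Hs']. apply rank_eq, Hu. split; auto. apply in_sep in Hs'. tauto.
Qed.

End Rank.


(** * Transfer of the result to V_k, and normalization of an ultrafilter *)

Section Transfer.

Context {V : Type} {E : Membership V} {HV : universe_of_sets V}.
Context (k : V) (Ul : (V -> Prop) -> Prop).
Context (Lk : limit_ordinal k) (Hw : omega ∈ k).
Context (HU : ultrafilter (fun i => i ∈ k) Ul) (HK : Ul (fun xi => xi ∈ k)).

Notation D := {x : V | inV k x}.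

Lemma rank_reflective (HN : normal Ul) :
  exists! r, predicate_on_V k r /\ V_satisfies_B1_B8 k r /\ Ul (fun xi => rel r xi xi).
Proof.
  assert (O : ordinal k) by apply Lk.
  pose proof (rank_universe Lk Hw HU HK) as HD.
  (* [up] lifts elements of V_k to [D]; the default [omega] is harmless because [Ul] concentrates on
     [k]. *)
  destruct (skolem (inhabits (exist _ _ (inV_self O Hw) : D)) (inV k)
    (fun x y => proj1_sig y = x)) as [up Hup].
  { intros x Hx. exists (exist _ x Hx). auto. }
  assert (Hup' : forall x : D, up (proj1_sig x) = x)
    by (intros [x Hx]; apply rank_eq; auto).
  assert (Hupk : forall xi, xi ∈ k -> proj1_sig (up xi) = xi)
    by (intros xi Hxi; apply Hup, inV_self; auto).
  set (U := fun P : D -> Prop => Ul (fun xi => P (up xi))).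
  assert (HUD : ultrafilter (fun _ => True) U).
  { unfold U. split.
    - intros P Q H. apply (uf_up HU). auto.
    - intros P. apply (uf_not HU).
    - intros P Q. apply (uf_and HU).
    - intros i P _ H.
      assert (H' : Ul (fun xi => forall y, y ∈ proj1_sig i -> P (up y) (up xi))).
      { apply (Ul_inter Lk HU); [apply proj2_sig|]. intros y Hy. apply H.
        unfold mem, mem_sub. simpl. rewrite Hup; auto.
        exact (inV_trans (proj1 O) Hy (proj2_sig i)). }
      revert H'. apply (uf_up HU). intros xi H' x Hx.
      specialize (H' (proj1_sig x) Hx). rewrite Hup' in H'. auto.
    - intros x H. apply (uf_nonprincipal HU (x := proj1_sig x)). revert H HK. apply (uf_up2 HU).
      intros xi <- Hxi. symmetry. auto. }
  assert (HND : normal U).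
  { intros h H. destruct (HN (fun xi => proj1_sig (h (up xi)))) as [c Hc].
    - revert H HK. apply (uf_up2 HU). intros xi H Hxi.
      unfold mem, mem_sub in H. simpl in H. rewrite Hupk in H; auto.
    - exists (up c). unfold U. revert Hc. apply (uf_up HU). intros xi <-. auto. }
  assert (HOD : U ordinal).
  { unfold U. revert HK. apply (uf_up HU). intros xi Hxi. apply rank_ordinal.
    rewrite Hupk; auto. exact (ordinal_elem O Hxi). }
  destruct (V_set k) as [v Hv].
  set (r := graph v v (fun x y => reflective U (up x) (up y))).
  assert (Hr : (fun x y : D => rel r (proj1_sig x) (proj1_sig y)) = reflective U).
  { apply functional_extensionality. intros x. apply functional_extensionality. intros y.
    apply propositional_extensionality. unfold r. rewrite rel_graph, !Hv, !Hup'.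
    pose proof (proj2_sig x). pose proof (proj2_sig y). tauto. }
  exists r. split; [split; [|split]|].
  - intros p Hp. apply in_graph in Hp as (x & y & Hp & Hx & Hy & _). exists x, y.
    rewrite is_opair_eq, <- !Hv. auto.
  - unfold V_satisfies_B1_B8. rewrite Hr. apply reflective_satisfies; auto.
  - pose proof (U_reflective_diag HUD HND HOD) as H. unfold U at 1 in H.
    revert H HK. apply (uf_up2 HU). intros xi H Hxi. rewrite <- Hr, Hupk in H; auto.
  - intros r' (Hp' & Hs' & Hd').
    assert (Hr' : (fun x y : D => rel r' (proj1_sig x) (proj1_sig y)) = reflective U).
    { apply (reflective_unique HUD HND HOD); auto. unfold U. revert Hd' HK.
      apply (uf_up2 HU). intros xi H Hxi. rewrite Hupk; auto. }
    rewrite <- Hr in Hr'.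
    (* Both predicates are sets of pairs from V_k, so agreement there makes them equal as sets. *)
    assert (Hrr : forall x y, inV k x -> inV k y -> (rel r' x y <-> rel r x y)).
    { intros x y Hx Hy. pose (x' := exist _ x Hx : D). pose (y' := exist _ y Hy : D).
      change ((fun x y : D => rel r' (proj1_sig x) (proj1_sig y)) x' y' <->
        (fun x y : D => rel r (proj1_sig x) (proj1_sig y)) x' y').
      rewrite Hr'. reflexivity. }
    apply set_ext. intros p. split; intros Hp.
    + pose proof Hp as Hp2. apply in_graph in Hp2 as (x & y & -> & Hx & Hy & _).
      apply Hv in Hx, Hy. apply rel_opair, Hrr, rel_opair; auto.
    + destruct (Hp' p Hp) as (x & y & Hxy & Hx & Hy). apply is_opair_eq in Hxy. subst p.
      apply rel_opair, Hrr, rel_opair; auto.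
Qed.

(** Pushing [Ul] forward along a function that is minimal, modulo [Ul], among those not
    bounded below [k] makes it normal. *)
Lemma normalize : exists Ul', ultrafilter (fun i => i ∈ k) Ul' /\ normal Ul' /\
  Ul' (fun xi => xi ∈ k).
Proof.
  assert (O : ordinal k) by apply Lk.
  destruct (proj1 (limit_ordinal_iff _) Lk) as (_ & _ & HS).
  set (G := fun h : V -> V => Ul (fun xi => h xi ∈ k) /\ forall a, a ∈ k -> Ul (fun xi => a ∈ h xi)).
  (* Without a minimal function, descending from the identity gives a sequence that decreases almost
     everywhere at each step. By countable completeness some single [xi] witnesses all steps,
     against well-foundedness. *)
  assert (Hmin : exists h, G h /\ forall g, G g -> ~ Ul (fun xi => g xi ∈ h xi)).
  { apply NNPP. intros N.
    destruct (skolem (inhabits (fun x : V => x)) G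
      (fun h g => G g /\ Ul (fun xi => g xi ∈ h xi))) as [f Hf].
    { intros h Hh. apply NNPP. intros N'. apply N. exists h. split; auto.
      intros g Hg Hgh. apply N'. eauto. }
    set (s := nat_rect (fun _ => V -> V) (fun x => x) (fun _ => f)).
    assert (Hs : forall n, G (s n)).
    { induction n as [|n IH].
      - split; auto. intros a Ha. apply (Ul_mem Lk HU HK Ha).
      - simpl. apply Hf. auto. }
    assert (H : Ul (fun xi => forall n, s (S n) xi ∈ s n xi)).
    { apply (uf_nat HU) with (w := omega) (P := fun n xi => s (S n) xi ∈ s n xi); auto.
      - intros n. apply in_omega. eauto.
      - intros n. simpl. apply Hf. auto. }
    destruct (uf_ex HU H) as [xi Hxi].
    destruct (mem_min (P := fun x => exists n, x = s n xi)) as (x & [n ->] & Hx).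
    { exists (s 0 xi), 0. auto. }
    apply (Hx _ (Hxi n)). eauto. }
  destruct Hmin as (h & [Hhk Hh] & Hmin).
  exists (fun P => Ul (fun xi => P (h xi))). split; [split|split]; auto.
  - intros P Q H. apply (uf_up HU). auto.
  - intros P. apply (uf_not HU).
  - intros P Q. apply (uf_and HU).
  - intros i P Hi H. apply (uf_inter HU) with (P := fun x xi => P x (h xi)); auto.
  - intros x H. destruct (uf_ex HU (uf_and HU H Hhk)) as (xi & <- & Hxi).
    destruct (uf_ex HU (uf_and HU H (Hh _ Hxi))) as (xi' & Heq & Hxi').
    rewrite Heq in Hxi'. exact (mem_irrefl Hxi').
  (* Either g(h xi) is bounded by some [a] below [k], hence constant by completeness, or the
     composite belongs to [G] and contradicts minimality. *)
  - intros g Hg. destruct (classic (exists a, a ∈ k /\ ~ Ul (fun xi => a ∈ g (h xi)))) as [(a & Ha & Na)|N].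
    + destruct (uf_const HU (h := fun xi => g (h xi)) (i := Succ a)) as (c & _ & Hc); eauto.
      apply (uf_not HU) in Na. generalize Na (uf_and HU Hg Hhk). apply (uf_up2 HU).
      intros xi H [Hgh Hhx]. assert (Hgk : g (h xi) ∈ k) by exact (ordinal_trans O Hhx Hgh).
      apply in_Succ.
      destruct (trichotomy (ordinal_elem O Hgk) (ordinal_elem O Ha)) as [|[|]]; tauto.
    + destruct (Hmin (fun xi => g (h xi))); auto. split.
      * generalize Hg Hhk. apply (uf_up2 HU). intros xi Hgh Hhx. exact (ordinal_trans O Hhx Hgh).
      * intros a Ha. apply NNPP. intros Na. apply N. eauto.
Qed.

End Transfer.

(** * From a measurable cardinal to a normal ultrafilter *)

Section Measure.

Context {V : Type} {E : Membership V} {HV : universe_of_sets V}.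

Lemma measure_ultrafilter (k m : V) : omega ∈ k -> measure_on k m ->
  ultrafilter (fun i => i ∈ k) (fun P => sep k P ∈ m).
Proof.
  intros Hw (H1 & H2 & H3 & H4 & H5).
  assert (Hsub : forall P, subset (sep k P) k) by (intros P z Hz; apply in_sep in Hz; tauto).
  assert (Hup : forall P Q : V -> Prop, (forall x, P x -> Q x) -> sep k P ∈ m -> sep k Q ∈ m).
  { intros P Q H HP. apply (H2 _ _ HP); auto. intros z. rewrite !in_sep. intuition. }
  assert (Hint : forall (i : V) (P : V -> V -> Prop), i ∈ k ->
    (forall x, x ∈ i -> sep k (P x) ∈ m) -> sep k (fun xi => forall x, x ∈ i -> P x xi) ∈ m).
  { intros i P Hi HP. set (f := graph i m (fun x y => y = sep k (P x))).
    apply (H4 i f); auto.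
    - split.
      + intros p Hp. apply in_graph in Hp as (x & y & -> & Hx & Hy & _). exists x, y.
        rewrite is_opair_eq. auto.
      + intros x Hx. exists (sep k (P x)). split; [apply rel_graph; auto|].
        intros y Hy. apply rel_graph in Hy. symmetry. tauto.
    - intros z. rewrite in_sep. split; intros [Hz H]; split; auto.
      + intros x X HX. apply rel_graph in HX as (Hx & _ & ->). apply in_sep. auto.
      + intros x Hx. assert (Hr : rel f x (sep k (P x))) by (apply rel_graph; auto).
        apply H in Hr. apply in_sep in Hr. tauto. }
  split; auto.
  - intros P. assert (H : sep k P ∈ m <-> ~ sep k (fun x => ~ P x) ∈ m).
    { apply H3; auto. intros z. rewrite !in_sep. tauto. }
    tauto.
  - intros P Q HP HQ.
    (* A binary intersection is an intersection over [omega] with [P] at index 0 and [Q] at all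
       others. *)
    refine (Hup _ _ _ (Hint omega (fun x xi => (x = emp -> P xi) /\ (x <> emp -> Q xi)) Hw _)).
    + intros xi H. split.
      * apply (H (num 0)); auto. apply in_omega. eauto.
      * apply (H (num 1)); [apply in_omega; eauto|]. intros H'.
        apply (in_emp (z := emp)). rewrite <- H' at 2. apply (num_lt (m := 0)). auto.
    + intros x _. destruct (classic (x = emp)).
      * revert HP. apply Hup. tauto.
      * revert HQ. apply Hup. tauto.
  - intros x H. destruct (classic (x ∈ k)) as [Hx|N].
    + apply (H5 x _ Hx) in H; auto. apply is_upair_eq, set_ext. intros z.
      rewrite in_sep, in_upair. intuition congruence.
    (* Here the measure one set would be empty, and then the singleton {omega} would have measure
       one too. *)
    + assert (He : upair omega omega ∈ m).
      { apply (H2 _ _ H).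
        - intros z Hz. apply in_sep in Hz as [Hz ->]. tauto.
        - intros z Hz. apply in_upair in Hz as [-> | ->]; auto. }
      revert He. apply (H5 omega); auto. apply is_upair_eq. reflexivity.
Qed.

Lemma measurable_normal (k : V) : measurable k ->
  limit_ordinal k /\ omega ∈ k /\ exists Ul, ultrafilter (fun i => i ∈ k) Ul /\ normal Ul /\
    Ul (fun xi => xi ∈ k).
Proof.
  intros [[[O _] (w & Hw & Hwk)] [m Hm]]. apply is_omega_eq in Hw. subst w.
  pose proof (measure_ultrafilter Hwk Hm) as HU.
  assert (HK : sep k (fun xi => xi ∈ k) ∈ m).
  { replace (sep k (fun xi => xi ∈ k)) with (sep k (fun _ => True)).
    - apply (uf_true HU). auto.
    - apply set_ext. intros z. rewrite !in_sep. tauto. }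
  assert (Lk : limit_ordinal k).
  { apply limit_ordinal_iff. split; [|split]; auto.
    - intros ->. exact (in_emp Hwk).
    (* If [k] were [Succ y], completeness over [y] and nonprincipality at [y] would remove every
       point of [k]. *)
    - intros y Hy. destruct (Succ_mem_or_eq O Hy) as [|Hk]; auto. exfalso.
      assert (Hne : forall x, sep k (fun xi => xi <> x) ∈ m)
        by (intros x; apply (uf_not HU), (uf_nonprincipal HU)).
      assert (H : sep k (fun xi => forall x, x ∈ y -> xi <> x) ∈ m)
        by (apply (uf_inter HU) with (P := fun x xi => xi <> x); auto).
      destruct (uf_ex HU (uf_and HU HK (uf_and HU H (Hne y)))) as (xi & Hxi & Hxi1 & Hxi2).
      rewrite <- Hk in Hxi. apply in_Succ in Hxi as [Hxi | Hxi]; auto. exact (Hxi1 _ Hxi eq_refl). }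
  split; [|split]; auto. exact (normalize Lk Hwk HU HK).
Qed.

End Measure.

(** * The normal ultrafilter derived from an elementary embedding *)

Section Embedding.

Context {V : Type} {E : Membership V} {HV : universe_of_sets V}.
Context (M : V -> Prop) (j : V -> V) (k : V).
Context (HM : forall x y, M x -> y ∈ x -> M y) (Hj : elementary_embedding j M).
Context (Hk : critical_point j k).

Definition V_or_M (U : V -> Prop) : Prop := U = everything \/ U = M.

Lemma V_or_M_transitive U : V_or_M U -> forall x z, U x -> z ∈ x -> U z.
Proof. intros [-> | ->] x z; [intros; exact I | apply HM]. Qed.

Definition env (a b c d : V) (n : nat) : V :=
  match n with 0 => a | 1 => b | 2 => c | _ => d end.

(** Elementarity leads from truth in [V] to truth in [M]; for a formula absolute between the two,
    the result is again a plain statement about sets. Four parameters suffice for all uses. *)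
Lemma elementary (Q : (nat -> V) -> Prop) (a b c d : V) :
  defin V_or_M I0 Q -> (Q (env a b c d) <-> Q (env (j a) (j b) (j c) (j d))).
Proof.
  intros [p Hp]. destruct Hj as [HjM Hel].
  rewrite <- (Hp everything (or_introl eq_refl)) by (intros; exact I).
  rewrite Hel.
  replace (fun v => j (env a b c d v)) with (env (j a) (j b) (j c) (j d)).
  - apply Hp; [right; auto|]. intros [|[|[|n]]]; simpl; auto.
  - apply functional_extensionality. intros [|[|[|n]]]; auto.
Qed.

Notation HW := V_or_M_transitive.

Lemma j_mem x y : x ∈ y <-> j x ∈ j y.
Proof. exact (elementary x y x x (def_mem 0 1)). Qed.

Lemma j_inj x y : j x = j y -> x = y.
Proof. apply (elementary x y x x (def_eq 0 1)). Qed.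

Lemma j_ordinal x : ordinal x -> ordinal (j x).
Proof. apply (elementary x x x x (def_ordinal HW 0)). Qed.

Lemma j_fixed a : a ∈ k -> j a = a.
Proof. apply Hk. Qed.

(** If [j k] were below [k], it would be fixed by [j], and injectivity would give [j k = k]. *)
Lemma k_in_jk : k ∈ j k.
Proof.
  destruct Hk as (O & Hne & Hfix).
  destruct (trichotomy (j_ordinal O) O) as [H | [H | H]]; auto; [|tauto].
  destruct Hne. apply j_inj. auto.
Qed.

Lemma critical_limit : limit_ordinal k.
Proof.
  destruct Hk as (O & Hne & Hfix).
  destruct (ordinal_cases O) as [H | [(y & Oy & H)|]]; auto; destruct Hne.
  - transitivity emp; auto. apply is_empty_eq. intros z Hz.
    (* Emptiness written with a bounded quantifier, so that it is absolute. *)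
    assert (He : forall d, d ∈ j k -> d <> d); [|exact (He z Hz eq_refl)].
    apply (elementary (Q := fun e => forall d, d ∈ e 0 -> d <> d) k k k k).
    + apply def_ball; [apply HW|]. apply def_not, def_eq.
    + intros d Hd. simpl in Hd. rewrite H in Hd. destruct (in_emp Hd).
  - assert (Hs : is_succ k y) by (apply is_succ_eq; auto).
    apply (elementary k y k k (def_succ HW 0 1)) in Hs. simpl in Hs.
    apply is_succ_eq in Hs. rewrite Hs, H. f_equal. apply Hfix. rewrite H. apply mem_Succ.
Qed.

(** [omega] has an absolute definition, so [j] fixes it, and it has no limit ordinal as an
    element. *)
Lemma critical_omega : omega ∈ k.
Proof.
  destruct Hk as (O & Hne & Hfix). pose proof (@is_omega_omega V E HV) as Hw.
  destruct (trichotomy (proj1 (proj1 Hw)) O) as [|[H|H]]; auto.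
  - destruct Hne. rewrite <- H. apply is_omega_eq.
    apply (elementary omega k k k (def_omega HW 0)). auto.
  - destruct (proj2 Hw _ H). apply critical_limit.
Qed.

Definition derived (P : V -> Prop) : Prop := k ∈ j (sep k P).

(** Each clause comes from a bounded statement about the sets [sep k P] in [V], moved by [j] and
    evaluated at the point [k] of [j k]. *)
Lemma derived_ultrafilter : ultrafilter (fun i => i ∈ k) derived.
Proof.
  unfold derived. pose proof k_in_jk as Hkk. split.
  - intros P Q H HP. 
    assert (Hs : subset (sep k P) (sep k Q)) by (intros z; rewrite !in_sep; intuition).
    apply (elementary (sep k P) (sep k Q) k k (def_subset HW 0 1)) in Hs. exact (Hs _ HP).
  - intros P.
    assert (H : forall z, z ∈ j k -> (z ∈ j (sep k (fun x => ~ P x)) <-> ~ z ∈ j (sep k P))).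
    { apply (elementary (Q := fun e => forall z, z ∈ e 0 -> (z ∈ e 1 <-> ~ z ∈ e 2))
        k (sep k (fun x => ~ P x)) (sep k P) k).
      - apply def_ball; [apply HW|]. apply def_equiv; [|apply def_not]; apply def_mem.
      - simpl. intros z Hz. rewrite !in_sep. tauto. }
    apply H. auto.
  - intros P Q HP HQ.
    assert (H : forall z, z ∈ j (sep k P) -> z ∈ j (sep k Q) -> z ∈ j (sep k (fun x => P x /\ Q x))).
    { apply (elementary (Q := fun e => forall z, z ∈ e 0 -> z ∈ e 1 -> z ∈ e 2)
        (sep k P) (sep k Q) (sep k (fun x => P x /\ Q x)) k).
      - apply def_ball; [apply HW|]. apply def_imp; apply def_mem.
      - simpl. intros z. rewrite !in_sep. tauto. }
    auto.
  (* The family is coded as one set so that [j] can be applied to it; [i] and its elements lie below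
     [k] and are not moved. *)
  - intros i P Hi HP. set (w := graph i k P).
    assert (HPi : forall x, x ∈ i -> rel (j w) x k).
    { intros x Hx.
      assert (Hxk : x ∈ k) by exact (ordinal_trans (proj1 Hk) Hi Hx).
      assert (H : forall z, z ∈ j (sep k (P x)) -> rel (j w) (j x) z).
      { apply (elementary (Q := fun e => forall z, z ∈ e 0 -> rel (e 1) (e 2) z) (sep k (P x)) w x k).
        - apply def_ball; [apply HW|]. apply def_rel, HW.
        - simpl. intros z Hz. apply in_sep in Hz as [Hz Hz']. apply rel_graph. auto. }
      rewrite (j_fixed Hxk) in H. auto. }
    assert (H : forall z, z ∈ j k -> (forall x, x ∈ j i -> rel (j w) x z) ->
      z ∈ j (sep k (fun xi => forall x, x ∈ i -> P x xi))).
    { apply (elementary (Q := fun e => forall z, z ∈ e 0 -> (forall x, x ∈ e 1 -> rel (e 2) x z) -> z ∈ e 3)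
        k i w (sep k (fun xi => forall x, x ∈ i -> P x xi))).
      - apply def_ball; [apply HW|]. apply def_imp; [|apply def_mem].
        apply def_ball; [apply HW|]. apply def_rel, HW.
      - simpl. intros z Hz Hr. apply in_sep. split; auto. intros x Hx.
        specialize (Hr x Hx). apply rel_graph in Hr. tauto. }
    apply H; auto. rewrite (j_fixed Hi). auto.
  - intros x H.
    assert (Hx : forall z, z ∈ j (sep k (fun xi => xi = x)) -> z = j x).
    { apply (elementary (Q := fun e => forall z, z ∈ e 0 -> z = e 1) (sep k (fun xi => xi = x)) x k k).
      - apply def_ball; [apply HW|]. apply def_eq.
      - simpl. intros z Hz. apply in_sep in Hz. tauto. }
    (* From k = j x and k in j k it follows that [x] is in [k], so j x = x and [k] would be an
       element of itself. *)
    apply Hx in H. pose proof k_in_jk as H'. rewrite H in H' at 1. apply j_mem in H'.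
    rewrite (j_fixed H') in H. subst. exact (mem_irrefl H').
Qed.

Lemma derived_k : derived (fun xi => xi ∈ k).
Proof.
  unfold derived. replace (sep k (fun xi => xi ∈ k)) with k; [exact k_in_jk|].
  apply set_ext. intros z. rewrite in_sep. tauto.
Qed.

Lemma derived_normal : normal derived.
Proof.
  intros h H. unfold derived in *.
  set (g := graph k k (fun x y => y = h x)).
  set (X := sep k (fun xi => h xi ∈ xi)) in *.
  assert (HX : forall z, z ∈ j X -> exists y, y ∈ z /\ rel (j g) z y).
  { apply (elementary (Q := fun e => forall z, z ∈ e 0 -> exists y, y ∈ z /\ rel (e 1) z y) X g k k).
    - apply def_ball; [apply HW|]. apply def_bex; [apply HW|]. apply def_rel, HW.
    - simpl. intros z Hz. apply in_sep in Hz as [Hz Hh]. exists (h z). split; auto.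
      apply rel_graph. split; [|split]; auto. exact (ordinal_trans (proj1 Hk) Hz Hh). }
  (* [c] is the value of [j g] at [k]; being below [k] it equals [j c], so [k] lies in the image of
     the set where [h] has value [c]. *)
  destruct (HX k H) as (c & Hc & Hr). exists c.
  assert (Hcr : forall z, z ∈ j k -> rel (j g) z (j c) -> z ∈ j (sep k (fun xi => h xi = c))).
  { apply (elementary (Q := fun e => forall z, z ∈ e 0 -> rel (e 1) z (e 2) -> z ∈ e 3)
      k g c (sep k (fun xi => h xi = c))).
    - apply def_ball; [apply HW|]. apply def_imp; [apply def_rel, HW | apply def_mem].
    - simpl. intros z Hz Hr'. apply rel_graph in Hr' as (_ & _ & ->). apply in_sep. auto. }
  apply Hcr; [exact k_in_jk|]. rewrite (j_fixed Hc). auto.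
Qed.

Lemma derived_diag r : derived (fun xi => rel r xi xi) <-> rel (j r) k k.
Proof.
  assert (H : forall z, z ∈ j k -> (z ∈ j (sep k (fun xi => rel r xi xi)) <-> rel (j r) z z)).
  { apply (elementary (Q := fun e => forall z, z ∈ e 0 -> (z ∈ e 1 <-> rel (e 2) z z))
      k (sep k (fun xi => rel r xi xi)) r k).
    - apply def_ball; [apply HW|]. apply def_equiv; [apply def_mem | apply def_rel, HW].
    - simpl. intros z Hz. rewrite in_sep. tauto. }
  apply H, k_in_jk.
Qed.

End Embedding.

Unset Implicit Arguments.

Theorem theorem13 (V : Type) (E : Membership V) (HV : universe_of_sets V) (k : V) :
  (measurable k ->
     exists r, predicate_on_V k r /\ V_satisfies_B1_B8 k r) /\
  (forall (M : V -> Prop) (j : V -> V),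
     inner_model M -> elementary_embedding j M -> critical_point j k ->
     exists! r, predicate_on_V k r /\ V_satisfies_B1_B8 k r /\ rel (j r) k k).
Proof.
  split.
  - intros H. destruct (measurable_normal H) as (Lk & Hw & Ul & HU & HN & HK).
    destruct (rank_reflective Lk Hw HU HK HN) as (r & (H1 & H2 & _) & _). eauto.
  - intros M j (HM & _ & _) Hj Hk.
    destruct (rank_reflective (critical_limit HM Hj Hk) (critical_omega HM Hj Hk)
      (derived_ultrafilter HM Hj Hk) (derived_k HM Hj Hk) (derived_normal HM Hj Hk))
      as (r & (H1 & H2 & H3) & Hu).
    exists r. split.
    + rewrite <- (derived_diag HM Hj Hk). auto.
    + intros r' H'. apply Hu. rewrite (derived_diag HM Hj Hk). auto.
Qed.
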